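(* Let $\mathbb{K}=\mathbb{R}$ or $\mathbb{C}$ and $d\ge 1$. Let $\rho:\mathcal{H}(d)\to[0,\infty)$ be the joint spectral radius. (i) If $\mathcal{M}\in\mathcal{H}(d)$ satisfies $\rho(\mathcal{M})=0$, then $\rho$ is Hölder continuous at $\mathcal{M}$ with exponent $\alpha=\frac1d$. (ii) $\rho$ is pointwise Hölder continuous on $\mathcal{H}(d)$ with exponent $\alpha=\frac{1}{d^2+d}$; that is, it is Hölder continuous at every $\mathcal{M}\in\mathcal{H}(d)$ with this exponent. (iii) Let $\mathcal{M}\in\mathcal{H}(d)$ be a finite set of matrices in $\mathbb{C}^{d\times d}$. For every $\varepsilon>0$, $\rho$ is Hölder continuous at $\mathcal{M}$ (as a function on $\mathcal{H}(d)$) with exponent $\alpha=\frac{1}{d+\varepsilon}$.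
   Context: $\mathcal{H}(d)$ is the set of nonempty compact subsets of $\mathbb{K}^{d\times d}$ with the Hausdorff metric $d_H(\mathcal{M},\mathcal{N})=\max\{\max_{A\in\mathcal{M}}\min_{B\in\mathcal{N}}\|A-B\|_2,\ \max_{B\in\mathcal{N}}\min_{A\in\mathcal{M}}\|A-B\|_2\}$, where $\|\cdot\|_2$ is the spectral norm. For $k\ge1$, $\mathcal{S}_k(\mathcal{M})=\{A_{k-1}\cdots A_0 : A_j\in\mathcal{M}\}$. The joint spectral radius is $\rho(\mathcal{M})=\lim_{k\to\infty}\sup\{\|S\| : S\in\mathcal{S}_k(\mathcal{M})\}^{1/k}$ (independent of the operator norm chosen). A function $f:X\to Z$ between metric spaces is Hölder continuous at $x_0\in X$ with exponent $\alpha$ if $\limsup_{x\to x_0,\,x\ne x_0} d_Z(f(x),f(x_0))/d_X(x,x_0)^\alpha<\infty$; it is pointwise Hölder continuous with exponent $\alpha$ if this holds at every $x_0\in X$. *)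

(* Defs.v *)
From HB Require Import structures.
From mathcomp Require Import all_boot all_order all_algebra.
From mathcomp Require Import all_classical all_reals all_analysis.
From mathcomp Require Import complex.
Import Order.TTheory GRing.Theory Num.Theory.
Import numFieldNormedType.Exports.

Set Implicit Arguments.
Unset Strict Implicit.
Unset Printing Implicit Defensive.

Local Open Scope classical_set_scope.
Local Open Scope ring_scope.

Variant scalar_kind := RealScalars | ComplexScalars.

Definition base_field (R : realType) (s : scalar_kind) : numFieldType :=
  match s with
  | RealScalars => R
  | ComplexScalars => R[i]
  end.

(* The library norm on R[i] takes its values in R[i]; all metric quantities
   below are R-valued. *)
Definition modulus (R : realType) (s : scalar_kind) : base_field R s -> R :=
  match s return base_field R s -> R with
  | RealScalars => fun x : R => `|x|
  | ComplexScalars => fun z : R[i] => complex.Re `|z|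
  end.

Section SpectralNorm.
Variables (R : realType) (s : scalar_kind) (d : nat).
Local Notation K := (base_field R s).

Definition euclidean_norm (x : 'cV[K]_d) : R :=
  Num.sqrt (\sum_(i < d) modulus (x i ord0) ^+ 2).

Definition spectral_norm (A : 'M[K]_d) : R :=
  sup [set euclidean_norm (A *m x) | x in [set x | euclidean_norm x <= 1]].

End SpectralNorm.

Section CompactSets.
Variables (R : realType) (s : scalar_kind) (d : nat).
Local Notation K := (base_field R s).

(* Compactness is for the product topology of 'M[K]_d, i.e. the topology
   defined by any norm. *)
Definition compacts : Type :=
  {M : set 'M[K]_d | M !=set0 /\ compact M}.

Definition carrier (M : compacts) : set 'M[K]_d := proj1_sig M.

(* On nonempty compact sets the outer sup and the inner inf are attained. *)
Definition excess (M N : compacts) : R :=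
  sup [set inf [set spectral_norm (A - B) | B in carrier N]
      | A in carrier M].

Definition hausdorff (M N : compacts) : R :=
  Num.max (excess M N) (excess N M).

(* The product A_{k-1} *m ... *m A_0, leftmost factor of highest index. *)
Definition products (k : nat) (M : compacts) : set 'M[K]_d :=
  [set \big[mulmx/1%:M]_(j < k) A (rev_ord j)
      | A in [set A : 'I_k -> 'M[K]_d | forall j, carrier M (A j)]].

(* The (irrelevant) term k = 0 of the sequence is 1, since 0^-1 = 0. *)
Definition joint_spectral_radius (M : compacts) : R :=
  lim ((sup [set spectral_norm S | S in products k M] `^ k%:R^-1)
         @[k --> \oo]).

End CompactSets.

Section Holder.
Variables (R : realType) (X Z : Type).
Variables (dX : X -> X -> R) (dZ : Z -> Z -> R).

Definition punctured_ball (x0 : X) (r : R) : set X :=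
  [set x | x <> x0 /\ dX x x0 < r].

(* [limf_esup] would need a filtered structure on X; this is the same
   infimum of suprema, over punctured balls, for bare distance functions. *)
Definition punctured_limsup (g : X -> R) (x0 : X) : \bar R :=
  ereal_inf [set ereal_sup [set (g x)%:E | x in punctured_ball x0 r]
            | r in [set r : R | 0 < r]].

Definition holder_at (f : X -> Z) (alpha : R) (x0 : X) : Prop :=
  (punctured_limsup (fun x => (dZ (f x) (f x0) / dX x x0 `^ alpha)%R) x0
     < +oo)%E.

Definition pointwise_holder (f : X -> Z) (alpha : R) : Prop :=
  forall x0, holder_at f alpha x0.

End Holder.

Definition real_dist (R : realType) (x y : R) : R := `|x - y|.

(* Main.v *)
Require Import Defs.
From mathcomp Require Import all_boot all_order all_algebra.
From mathcomp Require Import all_classical all_reals all_analysis.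
From mathcomp Require Import perm finmap complex.
From mathcomp Require Import ring lra.
Import Order.TTheory GRing.Theory Num.Theory.
Import numFieldNormedType.Exports ComplexField.Normc.


(** At every compact set [M] the joint spectral radius is Hoelder continuous
    with exponent [1/d] (lemma [holder_joint_spectral_radius]). Each of the
    three claims is an instance, since a smaller exponent is weaker for small
    distances.

    Let [r] be the joint spectral radius of [M]; it is the critical exponential
    rate of the products of elements of [M] (predicate [is_rate]). Two facts on
    products carry the proof.

    - Polynomial growth ([polynomial_growth]): if [r = 1], products of length
      [k] are [O(k^(d-1))]. Each order of growth adds at least one dimension to
      the space of vectors with at most this growth, because modulo this
      space, by compactness of the sphere, some vector has a bounded orbit.
    - Bochi's inequality ([bochi]): if in some norm all elements of a set have
      norm at most [b], then products of [d] of them have norm at most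
      [c l b^(d-1)] for each [l] above the rate of the set, with [c] depending
      on [d] only.

    By the first fact, for [0 < t <= 1] there is a norm in which the elements of
    [M] have norm at most [r + t] and which is equivalent to the given norm
    up to a factor [O(t^(1-d))] ([rate_wbound], [perturbation_norm]; if [r = 0],
    the products of length [d] vanish by the second fact). A perturbation of
    size [t^d] has norm [O(t)] in it. So a set [N] at distance [t^d] from [M] has
    rate at most [r + O(t)].

    For the lower bound ([rate_lower]) compare products of length [d n] in the
    same norm, with [n] a small multiple of [1/t]. All their norms are at most
    [(r + O(t))^(d n)], those of [M] reach [r^(d n)], and those of [N] differ from
    them by a small fraction. So some product of [N] of length [d n] has norm
    at least a fixed fraction of [(r + O(t))^(d n)]. Apply Bochi's inequality to
    the set of products of length [n] of elements of [N]: the rate [p] of [N]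
    satisfies [p^n >= c' (r + O(t))^n] with a constant [c'], and taking [n]-th
    roots costs only [O(1/n) = O(t)]. What makes this work is that the constant
    in Bochi's inequality does not depend on the norm, although the norm
    degenerates as [t] tends to [0]. *)

Set Implicit Arguments.
Unset Strict Implicit.
Unset Printing Implicit Defensive.

Local Open Scope classical_set_scope.
Local Open Scope ring_scope.

(** * The modulus and the entry norm *)

Section Modulus.
Variables (R : realType) (s : scalar_kind).
Local Notation K := (base_field R s).
Implicit Types x y : K.

Definition embed : R -> K :=
  match s return R -> base_field R s with
  | RealScalars => fun r => r
  | ComplexScalars => fun r => r%:C%C
  end.

Lemma modulusC_normc (R' : realType) (z : R'[i]) :
  @modulus R' ComplexScalars z = normc z.
Proof. by []. Qed.

Lemma modulus_ge0 x : 0 <= modulus x.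
Proof.
by case: s x => x; [exact: normr_ge0 | case: x => a b; exact: sqrtr_ge0].
Qed.

Lemma modulus0 : modulus (0 : K) = 0.
Proof. by case: s; [exact: normr0 | rewrite modulusC_normc normc0]. Qed.

Lemma modulus1 : modulus (1 : K) = 1.
Proof. by case: s; [exact: normr1 | rewrite modulusC_normc normc1]. Qed.

Lemma modulus_eq0 x : (modulus x == 0) = (x == 0).
Proof.
case: s x => x; first exact: normr_eq0.
apply/eqP/eqP => [|->]; last by rewrite modulusC_normc normc0.
by rewrite modulusC_normc => /eq0_normc.
Qed.

Lemma modulusM x y : modulus (x * y) = modulus x * modulus y.
Proof.
by case: s x y => x y; [exact: normrM | rewrite !modulusC_normc normcM].
Qed.

Lemma modulusN x : modulus (- x) = modulus x.
Proof.
by case: s x => x; [exact: normrN | rewrite !modulusC_normc normcN].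
Qed.

Lemma modulusD x y : modulus (x + y) <= modulus x + modulus y.
Proof.
by case: s x y => x y; [exact: ler_normD | exact: le_normcD].
Qed.

Lemma modulusV x : modulus x^-1 = (modulus x)^-1.
Proof.
have [->|x0] := eqVneq x 0; first by rewrite invr0 modulus0 invr0.
apply: (@mulfI _ (modulus x)); first by rewrite modulus_eq0.
by rewrite -modulusM !divff ?modulus1 ?modulus_eq0.
Qed.

Lemma modulus_embed (r : R) : modulus (embed r) = `|r|.
Proof.
rewrite /embed; case: s => //.
by rewrite modulusC_normc /= expr0n addr0 sqrtr_sqr.
Qed.

Lemma modulus_prod (I : Type) (r : seq I) (P : pred I) (F : I -> K) :
  modulus (\prod_(i <- r | P i) F i) = \prod_(i <- r | P i) modulus (F i).
Proof. by apply: (big_morph _ modulusM modulus1). Qed.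

Lemma modulus_sum (I : Type) (r : seq I) (P : pred I) (F : I -> K) :
  modulus (\sum_(i <- r | P i) F i) <= \sum_(i <- r | P i) modulus (F i).
Proof.
elim/big_rec2: _ => [|i y x _ yx]; first by rewrite modulus0.
by rewrite (le_trans (modulusD _ _))// lerD2l.
Qed.

Lemma modulusB x y : modulus (x - y) = modulus (y - x).
Proof. by rewrite -opprB modulusN. Qed.

(** The real and imaginary parts reduce sequential compactness over either
    field to the compactness of bounded closed sets of real vectors. *)
Lemma modulus_parts :
  exists f g : K -> R, [/\ forall x, `|f x| <= modulus x,
    forall x, `|g x| <= modulus x,
    forall a b, exists x, f x = a /\ (g x = b \/ forall y, g y = 0)
  & forall x y, modulus (x - y) <= `|f x - f y| + `|g x - g y|].
Proof.
case: s.
  exists id, (fun=> 0); split=> //.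
  - by move=> x; rewrite normr0; exact: normr_ge0.
  - by move=> a b; exists a; split=> //; right.
  - by move=> x y; rewrite subrr normr0 addr0.
exists (@complex.Re R), (@complex.Im R); split=> //.
- move=> [a b]; rewrite modulusC_normc /= -sqrtr_sqr ler_wsqrtr//.
  by rewrite lerDl sqr_ge0.
- move=> [a b]; rewrite modulusC_normc /= -sqrtr_sqr ler_wsqrtr//.
  by rewrite lerDr sqr_ge0.
- by move=> a b; exists (a +i* b)%C; split=> //; left.
- move=> [a b] [c e]; rewrite modulusC_normc /=.
  rewrite -[leRHS]ger0_norm ?addr_ge0// -sqrtr_sqr ler_wsqrtr//.
  rewrite [leRHS]sqrrD !real_normK ?num_real// -addrA lerD2l lerDr.
  by rewrite mulrn_wge0// mulr_ge0.
Qed.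

End Modulus.

Section EntryNorm.
Variables (R : realType) (s : scalar_kind).
Local Notation K := (base_field R s).

(** The sum of the moduli is submultiplicative for all rectangular formats,
    with constant 1. *)
Definition mnorm p q (A : 'M[K]_(p, q)) : R :=
  \sum_i \sum_j modulus (A i j).

Lemma mnorm_ge0 p q (A : 'M[K]_(p, q)) : 0 <= mnorm A.
Proof. by apply: sumr_ge0 => i _; apply: sumr_ge0 => j _; exact: modulus_ge0. Qed.
#[local] Hint Resolve mnorm_ge0 modulus_ge0 : core.

Lemma modulus_le_mnorm p q (A : 'M[K]_(p, q)) i j : modulus (A i j) <= mnorm A.
Proof.
rewrite /mnorm (bigD1 i)//= (bigD1 j)//= -addrA lerDl.
apply: addr_ge0; apply: sumr_ge0 => k _; first exact: modulus_ge0.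
by apply: sumr_ge0 => l _; exact: modulus_ge0.
Qed.

Lemma mnorm_le p q (A : 'M[K]_(p, q)) (c : R) :
  (forall i j, modulus (A i j) <= c) -> mnorm A <= (p * q)%:R * c.
Proof.
move=> Ac; apply: (@le_trans _ _ (\sum_(i < p) \sum_(j < q) c)).
  by apply: ler_sum => i _; apply: ler_sum => j _.
by rewrite !sumr_const !card_ord -mulrnA mulr_natl mulnC.
Qed.

Lemma mnorm0 p q : mnorm (0 : 'M[K]_(p, q)) = 0.
Proof. by apply: big1 => i _; apply: big1 => j _; rewrite mxE modulus0. Qed.

Lemma mnorm_eq0 p q (A : 'M[K]_(p, q)) : mnorm A = 0 -> A = 0.
Proof.
move=> A0; apply/matrixP => i j; rewrite mxE; apply/eqP.
by rewrite -modulus_eq0 eq_le modulus_ge0 andbT -A0 modulus_le_mnorm.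
Qed.

Lemma mnormN p q (A : 'M[K]_(p, q)) : mnorm (- A) = mnorm A.
Proof.
by apply: eq_bigr => i _; apply: eq_bigr => j _; rewrite mxE modulusN.
Qed.

Lemma mnormD p q (A B : 'M[K]_(p, q)) : mnorm (A + B) <= mnorm A + mnorm B.
Proof.
rewrite /mnorm -big_split; apply: ler_sum => i _.
by rewrite -big_split; apply: ler_sum => j _; rewrite mxE modulusD.
Qed.

Lemma mnormZ p q (c : K) (A : 'M[K]_(p, q)) : mnorm (c *: A) = modulus c * mnorm A.
Proof.
rewrite /mnorm mulr_sumr; apply: eq_bigr => i _.
by rewrite mulr_sumr; apply: eq_bigr => j _; rewrite mxE modulusM.
Qed.

Lemma mnormM p q r (A : 'M[K]_(p, q)) (B : 'M[K]_(q, r)) :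
  mnorm (A *m B) <= mnorm A * mnorm B.
Proof.
rewrite /mnorm mulr_suml; apply: ler_sum => i _.
rewrite mulr_suml.
apply: (@le_trans _ _ (\sum_j \sum_k modulus (A i k) * modulus (B k j))).
  apply: ler_sum => j _; rewrite mxE (le_trans (modulus_sum _ _ _))//.
  by apply: ler_sum => k _; rewrite modulusM.
rewrite exchange_big /=; apply: ler_sum => k _.
rewrite -mulr_sumr; apply: ler_wpM2l; first exact: modulus_ge0.
rewrite [leRHS](bigD1 k)//= lerDl; apply: sumr_ge0 => l _.
by apply: sumr_ge0 => j _; exact: modulus_ge0.
Qed.

Lemma mnormM_le p q r (A : 'M[K]_(p, q)) (B : 'M[K]_(q, r)) a b :
  mnorm A <= a -> mnorm B <= b -> mnorm (A *m B) <= a * b.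
Proof. by move=> Aa Bb; rewrite (le_trans (mnormM _ _))// ler_pM// mnorm_ge0. Qed.

Lemma mnorm_tr p q (A : 'M[K]_(p, q)) : mnorm A^T = mnorm A.
Proof.
rewrite /mnorm exchange_big; apply: eq_bigr => i _.
by apply: eq_bigr => j _; rewrite mxE.
Qed.

Lemma mnorm_row_mx p q r (A : 'M[K]_(p, q)) (B : 'M[K]_(p, r)) :
  mnorm (row_mx A B) = mnorm A + mnorm B.
Proof.
rewrite /mnorm -big_split /=; apply: eq_bigr => i _.
rewrite big_split_ord /=.
by congr (_ + _); apply: eq_bigr => j _; rewrite ?row_mxEl ?row_mxEr.
Qed.

Lemma mnorm_col_mx p q r (A : 'M[K]_(p, r)) (B : 'M[K]_(q, r)) :
  mnorm (col_mx A B) = mnorm A + mnorm B.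
Proof. by rewrite -mnorm_tr tr_col_mx mnorm_row_mx !mnorm_tr. Qed.

Lemma mnorm_perm n (sg : 'S_n) : mnorm (perm_mx sg : 'M[K]_n) = n%:R.
Proof.
rewrite /mnorm (eq_bigr (fun=> 1)) ?sumr_const ?card_ord// => i _.
rewrite (bigD1 (sg i))//= !mxE eqxx modulus1 big1 ?addr0// => j ij.
by rewrite !mxE eq_sym (negbTE ij) modulus0.
Qed.

Lemma mnorm1 n : mnorm (1%:M : 'M[K]_n) = n%:R.
Proof. by rewrite -perm_mx1 mnorm_perm. Qed.

Lemma mnorm_det n (A : 'M[K]_n) : modulus (\det A) <= (n`!)%:R * mnorm A ^+ n.
Proof.
rewrite (le_trans (modulus_sum _ _ _))//.
apply: (@le_trans _ _ (\sum_(sg : 'S_n) mnorm A ^+ n)).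
  apply: ler_sum => sg _; rewrite modulusM modulus_prod.
  have -> : modulus ((-1) ^+ sg : K) = 1.
    by case: (odd_perm sg); rewrite ?expr0 ?expr1 ?modulusN modulus1.
  rewrite mul1r; have -> : mnorm A ^+ n = \prod_(i < n) mnorm A.
    by rewrite prodr_const card_ord.
  by apply: ler_prod => i _; rewrite modulus_ge0 modulus_le_mnorm.
by rewrite sumr_const card_Sn mulr_natl.
Qed.

Lemma compact_mnorm_bounded n (M : set 'M[K]_n) :
  compact M -> exists2 c : R, 0 < c & forall A, M A -> mnorm A <= c.
Proof.
rewrite compact_cover => Mco.
have covM : M `<=` \bigcup_(k : nat) [set A | forall i j, modulus (A i j) < k%:R].
  move=> A _; exists (Num.truncn (mnorm A)).+1 => //= i j.
  by rewrite (le_lt_trans (modulus_le_mnorm _ _ _))// truncnS_gt.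
have /Mco [] := covM.
  move=> k _; rewrite openE => A /= Ak.
  apply/nbhs_ballP.
  have [e e0 He] : exists2 e : R, 0 < e &
      forall i j (y : K), modulus (A i j - y) < e -> modulus y < k%:R.
    pose e := \big[Num.min/1]_(x : 'I_n * 'I_n) (k%:R - modulus (A x.1 x.2)).
    exists e.
      by apply/bigmin_gtP; split=> // x _; rewrite subr_gt0.
    move=> i j y Ay; have : e <= k%:R - modulus (A i j).
      exact: (bigmin_le 1 (i, j) (fun x => k%:R - modulus (A x.1 x.2))).
    move=> /(lt_le_trans Ay); rewrite ltrBrDr; apply: le_lt_trans.
    rewrite -{1}(subrK (A i j) y) (le_trans (modulusD _ _))// lerD2r.
    by rewrite modulusB.
  have ee0 : 0 < embed s e.
    by move: e0; clear; rewrite /embed; case: s => //= e0; rewrite ltcR.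
  exists (embed s e) => // B [_ AB] i j; apply: (He i j).
  move: (AB i j); rewrite -ball_normE /=.
  move: (A i j - B i j); clear; rewrite /embed /modulus; case: s => //= z.
  by rewrite ltcE => /andP[].
move=> D _ DcovM.
exists ((n * n)%:R * \sum_(k <- enum_fset D) k%:R + 1).
  by rewrite ltr_wpDl// mulr_ge0// sumr_ge0.
move=> A /DcovM[k Dk Ak].
rewrite (@le_trans _ _ ((n * n)%:R * \sum_(k <- enum_fset D) k%:R)) ?lerDl//.
apply: mnorm_le => i j.
rewrite (le_trans (ltW (Ak i j)))//.
rewrite (bigD1_seq k) ?fset_uniq//= lerDl sumr_ge0//.
Qed.

Lemma bounded_rV_cluster n (x : nat -> 'rV[K]_n) (c : R) :
  (forall k, mnorm (x k) <= c) ->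
  exists y : 'rV[K]_n, forall (e : R) N, 0 < e ->
    exists2 k, (N <= k)%N & mnorm (x k - y) <= e.
Proof.
move=> xc; have [f [g [fm gm fg mfg]]] := modulus_parts R s.
pose A : set 'rV[R]_(n + n) := [set v | forall i, v ord0 i \in `[- c, c]].
have cA : compact A.
  apply: (@rV_compact _ _ (fun=> `[- c, c]%classic)).
  by move=> _; exact: segment_compact.
pose u k : 'rV[R]_(n + n) :=
  row_mx (map_mx f (x k)) (map_mx g (x k)).
have Au k : A (u k).
  move=> i; rewrite in_itv /= -ler_norml /u mxE.
  case: splitP => j _; rewrite mxE.
    exact: le_trans (le_trans (fm _) (modulus_le_mnorm _ _ _)) (xc k).
  exact: le_trans (le_trans (gm _) (modulus_le_mnorm _ _ _)) (xc k).
have [v [_ clv]] : exists v, A v /\ cluster (u @ \oo) v.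
  have [|v [? ?]] := cA (u @ \oo) _.
    by exists 0%N => // k _; exact: Au.
  by exists v.
have /choice[y Hy] : forall i : 'I_n, exists z : K,
    f z = v ord0 (lshift n i) /\
    (g z = v ord0 (rshift n i) \/ forall t, g t = 0) by move=> i; exact: fg.
exists (\row_i y i) => e N e0.
pose h := e / (n%:R *+ 2 + 1).
have n0 : 0 < n%:R *+ 2 + 1 :> R by rewrite ltr_wpDl// mulrn_wge0.
have h0 : 0 < h by rewrite divr_gt0.
have [|w []] := clv (u @` [set k | (N <= k)%N]) (ball v h) _ (nbhsx_ballx _ _ h0).
  by exists N => // k /= Nk; exists k.
move=> [k /= Nk <-] [_ vuh].
exists k => //; rewrite /mnorm big_ord1.
apply: (@le_trans _ _ (\sum_(j < n) (h *+ 2))).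
  apply: ler_sum => j _; rewrite !mxE (le_trans (mfg _ _))// mulr2n.
  have := vuh ord0 (lshift n j); have := vuh ord0 (rshift n j).
  rewrite -!ball_normE /= /u row_mxEl row_mxEr !mxE.
  have [-> gy] := Hy j => vg vf.
  apply: lerD; first by rewrite distrC ltW.
  case: gy => [->|gy]; first by rewrite distrC ltW.
  by rewrite !gy subrr normr0 ltW.
rewrite sumr_const card_ord -mulrnA -mulr_natr mulnC mulrnA.
have -> : e = h * (n%:R *+ 2 + 1) by rewrite /h divfK// gt_eqF.
by apply: ler_wpM2l; [exact: ltW | rewrite lerDl].
Qed.

End EntryNorm.
#[local] Hint Resolve mnorm_ge0 modulus_ge0 : core.

(** * Products of matrices and adapted norms *)

Section Words.
Variables (R : realType) (s : scalar_kind) (d : nat).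
Local Notation K := (base_field R s).
Implicit Types (M : set 'M[K]_d) (A S T : 'M[K]_d) (x y : 'cV[K]_d).

Fixpoint word M k : set 'M[K]_d :=
  if k is k'.+1 then [set A *m S | A in M & S in word M k'] else [set 1%:M].

Lemma wordD M k l S T : word M k S -> word M l T -> word M (k + l) (S *m T).
Proof.
elim: k S => [S -> wT|k IH _ [A MA [S wS <-]] wT]; first by rewrite mul1mx.
by exists A => //; exists (S *m T); [exact: IH | rewrite mulmxA].
Qed.

Lemma word_split M k l S : word M (k + l) S ->
  exists S1 S2, [/\ word M k S1, word M l S2 & S = S1 *m S2].
Proof.
elim: k S => [S wS|k IH _ [A MA [S /IH[S1 [S2 [w1 w2 ->]]] <-]]].
  by exists 1%:M, S; rewrite mul1mx.
by exists (A *m S1), S2; split; rewrite ?mulmxA//; exists A => //; exists S1.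
Qed.

Lemma word1 M : word M 1 = M.
Proof.
apply/seteqP; split=> [_ [A MA [_ -> <-]]|A MA]; first by rewrite mulmx1.
by exists A => //; exists 1%:M; rewrite ?mulmx1.
Qed.

Lemma word_rcons M k S A : word M k S -> M A -> word M k.+1 (S *m A).
Proof. by move=> wS MA; rewrite -addn1; apply: wordD; rewrite ?word1. Qed.

Lemma word_word M k n : word (word M n) k = word M (k * n).
Proof.
elim: k => [|k IH]; first by rewrite mul0n.
apply/seteqP; split=> [T [A wA [S]]|S].
  by move=> wS <-; rewrite mulSn; apply: wordD => //; rewrite -IH.
rewrite mulSn => /word_split[S1 [S2 [w1 w2 ->]]].
by exists S1 => //; exists S2 => //; rewrite IH.
Qed.

Definition mbounded M c := forall A, M A -> mnorm A <= c.

Definition wbound M l C := forall k S, word M k S -> mnorm S <= C * l ^+ k.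

Lemma word_mnorm M c k S : 0 <= c -> mbounded M c -> word M k S ->
  mnorm S <= d%:R * c ^+ k.
Proof.
move=> c0 Mc; elim: k S => [S ->|k IH _ [A MA [S /IH Sk <-]]].
  by rewrite mnorm1 mulr1.
by rewrite exprS mulrCA; apply: mnormM_le => //; exact: Mc.
Qed.

Lemma wbound_word M l C n : wbound M l C -> wbound (word M n) (l ^+ n) C.
Proof. by move=> wM k S; rewrite word_word => /wM; rewrite mulnC exprM. Qed.

(** The remainder of the length modulo [m] contributes a bounded factor. *)
Lemma wbound_of_power M c l m C : 0 < c -> mbounded M c -> 0 < l -> (0 < m)%N ->
  wbound (word M m) (l ^+ m) C -> exists C', wbound M l C'.
Proof.
move=> c0 Mc l0 m0 ml.
exists (C * (d%:R * \sum_(r < m) (c / l) ^+ r)) => k.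
rewrite {1 2}(divn_eq k m) => _ /word_split[S1 [S2 [w1 w2 ->]]].
have E1 : mnorm S1 <= C * (l ^+ m) ^+ (k %/ m).
  by move: w1; rewrite -word_word; exact: ml.
have E2 : mnorm S2 <= d%:R * (\sum_(r < m) (c / l) ^+ r) * l ^+ (k %% m).
  rewrite (le_trans (word_mnorm (ltW c0) Mc w2))// -mulrA.
  apply: ler_wpM2l => //.
  have cl : 0 <= c / l by rewrite divr_ge0 ?ltW.
  have -> : c ^+ (k %% m) = (c / l) ^+ (k %% m) * l ^+ (k %% m).
    by rewrite -exprMn divfK// gt_eqF.
  apply: ler_wpM2r; first by rewrite exprn_ge0 ?ltW.
  rewrite (bigD1 (Ordinal (ltn_pmod k m0)))//= lerDl sumr_ge0// => i _.
  by rewrite exprn_ge0.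
rewrite exprD mulnC exprM (le_trans (mnormM_le E1 E2))//.
by rewrite le_eqVlt; apply/orP; left; apply/eqP; ring.
Qed.

Lemma wbound_of_length M c l m : 0 < c -> mbounded M c -> 0 < l -> (0 < m)%N ->
  (forall S, word M m S -> mnorm S <= l ^+ m) -> exists C, wbound M l C.
Proof.
move=> c0 Mc l0 m0 ml; apply: (wbound_of_power c0 Mc l0 m0 (C := d%:R)).
by move=> k S; apply: word_mnorm => //; rewrite exprn_ge0 ?ltW.
Qed.

(** Norms matter up to a multiplicative constant only, so the lower bound is
    normalized to the entry norm. *)
Record normlike (C : R) (v : 'cV[K]_d -> R) : Prop := Normlike {
  normlikeD : forall x y, v (x + y) <= v x + v y;
  normlikeZ : forall a x, v (a *: x) = modulus a * v x;
  normlike_low : forall x, mnorm x <= v x;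
  normlike_up : forall x, v x <= C * mnorm x }.

(** The operator norm of [A] for the norm [v] is at most [b]; only such bounds
    occur, never the operator norm itself. *)
Definition lip (v : 'cV[K]_d -> R) (b : R) A := forall x, v (A *m x) <= b * v x.

Lemma mnorm_normlike : normlike 1 (@mnorm R s d 1).
Proof.
by split=> *; rewrite ?mul1r; [exact: mnormD | exact: mnormZ | |].
Qed.

Lemma normlike_ge0 C v x : normlike C v -> 0 <= v x.
Proof. by move=> nv; rewrite (le_trans (mnorm_ge0 x))// (normlike_low nv). Qed.

Lemma lip_word C v b M k S : normlike C v -> 0 <= b ->
  (forall A, M A -> lip v b A) -> word M k S -> lip v (b ^+ k) S.
Proof.
move=> nv b0 Mb; elim: k S => [S -> x|k IH _ [A MA [S /IH Sk <-]] x].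
  by rewrite mul1mx mul1r.
rewrite -mulmxA exprS -mulrA (le_trans (Mb _ MA _))//.
by apply: ler_wpM2l => //; exact: Sk.
Qed.

Lemma mnorm_delta j : mnorm (delta_mx j 0 : 'cV[K]_d) = 1.
Proof.
rewrite /mnorm (bigD1 j)//= big_ord1 mxE !eqxx modulus1 big1 ?addr0// => i ij.
by rewrite big_ord1 mxE (negbTE ij) modulus0.
Qed.

Lemma lip_mnorm C v b S : normlike C v -> 0 <= b ->
  lip v b S -> mnorm S <= d%:R * (b * C).
Proof.
move=> nv b0 Sb; rewrite /mnorm exchange_big /=.
rewrite mulr_natl -[d in leRHS]card_ord -sumr_const; apply: ler_sum => j _.
have -> : \sum_i modulus (S i j) = mnorm (S *m delta_mx j 0 : 'cV[K]_d).
  by rewrite -colE /mnorm; apply: eq_bigr => i _; rewrite big_ord1 mxE.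
rewrite (le_trans (normlike_low nv _))// (le_trans (Sb _))// ler_wpM2l//.
rewrite (le_trans (normlike_up nv _))//.
by rewrite mnorm_delta mulr1.
Qed.

(** Discounting the orbit of a vector by [l] per step: one more factor shifts the
    orbit by one step, so it can increase the supremum by a factor [l] only. *)
Definition adapted M l x : R :=
  sup [set r | exists k S, word M k S /\ r = (l ^+ k)^-1 * mnorm (S *m x)].

Section Adapted.
Variables (M : set 'M[K]_d) (l C : R).
Hypotheses (l0 : 0 < l) (wM : wbound M l C).

Lemma adapted_bound k S x : word M k S -> 
  (l ^+ k)^-1 * mnorm (S *m x) <= C * mnorm x.
Proof.
move=> wS; rewrite mulrC ler_pdivrMr ?exprn_gt0// mulrAC.
by apply: mnormM_le => //; exact: wM.
Qed.

Lemma adapted_ge k S x : word M k S ->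
  (l ^+ k)^-1 * mnorm (S *m x) <= adapted M l x.
Proof.
move=> wS; apply: ub_le_sup; last by exists k, S.
by exists (C * mnorm x) => _ [j [T [wT ->]]]; exact: adapted_bound.
Qed.

Lemma adapted_le x a :
  (forall k S, word M k S -> (l ^+ k)^-1 * mnorm (S *m x) <= a) ->
  adapted M l x <= a.
Proof.
move=> H; apply: ge_sup; first by exists ((l ^+ 0)^-1 * mnorm (1%:M *m x)), 0%N, 1%:M.
by move=> _ [k [S [wS ->]]]; exact: H.
Qed.

Lemma adapted_normlike : normlike C (adapted M l).
Proof.
have li k : 0 <= (l ^+ k)^-1 by rewrite invr_ge0 exprn_ge0 ?ltW.
have adZ a x : adapted M l (a *: x) <= modulus a * adapted M l x.
  apply: adapted_le => k S wS; rewrite -scalemxAr mnormZ mulrCA.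
  by apply: ler_wpM2l; [exact: modulus_ge0 | exact: adapted_ge].
split=> [x y|a x|x|x].
- apply: adapted_le => k S wS; rewrite mulmxDr.
  apply: (le_trans (ler_wpM2l (li k) (mnormD _ _))).
  by rewrite mulrDr; apply: lerD; exact: adapted_ge.
- apply/eqP; rewrite eq_le adZ /=.
  have [->|a0] := eqVneq a 0.
    rewrite modulus0 mul0r; apply: le_trans (adapted_ge _ (erefl : word M 0 1%:M)).
    by apply: mulr_ge0; [exact: li | exact: mnorm_ge0].
  rewrite -{1}[x](scalerK a0) (le_trans (ler_wpM2l (modulus_ge0 a) (adZ _ _)))//.
  by rewrite mulrA modulusV divff ?modulus_eq0// mul1r.
- by have := adapted_ge x (erefl : word M 0 1%:M); rewrite invr1 mul1r mul1mx.
- by apply: adapted_le => k S; exact: adapted_bound.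
Qed.

Lemma adapted_lip A : M A -> lip (adapted M l) l A.
Proof.
move=> MA x; apply: adapted_le => k S wS; rewrite mulmxA.
have := adapted_ge x (word_rcons wS MA).
by rewrite exprSr invfM -mulrA mulrCA ler_pdivrMl// mulrC.
Qed.

End Adapted.

(** An approximate Auerbach basis: unit vectors spanning at least half of the
    largest possible determinant. By Cramer's rule, a coordinate of a unit
    vector larger than 2 would allow an exchange increasing the determinant
    beyond its supremum. *)
Lemma auerbach C v : 0 < C -> normlike C v -> exists Y,
  [/\ Y \in unitmx, forall x, mnorm (invmx Y *m x) <= d%:R * 2 * v x
    & forall x, v (Y *m x) <= mnorm x].
Proof.
move=> C0 nv.
pose E := [set modulus (\det X) | X in [set X : 'M[K]_d | forall j, v (col j X) <= 1]].
have supE : has_sup E.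
  split; first by exists (modulus (\det (0 : 'M[K]_d))), 0 => //= j; 
    rewrite (_ : col j 0 = 0 *: 0) ?(normlikeZ nv) ?modulus0 ?mul0r// scaler0; 
    apply/matrixP => ? ?; rewrite !mxE.
  exists (d`!%:R * d%:R ^+ d) => _ [X /= vX <-].
  rewrite (le_trans (mnorm_det _))// ler_wpM2l// lerXn2r ?nnegrE ?mnorm_ge0//.
  rewrite /mnorm exchange_big /= -[d in leRHS]card_ord -sumr_const.
  apply: ler_sum => j _; apply: le_trans (vX j).
  apply: le_trans (normlike_low nv _).
  by apply: ler_sum => i _; rewrite big_ord1 mxE.
have E0 : 0 < sup E.
  pose c := embed s C^-1.
  have mc : modulus c = C^-1 by rewrite modulus_embed ger0_norm// invr_ge0 ltW.
  apply: (@lt_le_trans _ _ (modulus (\det (c%:M : 'M[K]_d)))).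
    have -> : \det (c%:M : 'M[K]_d) = \prod_(i < d) c.
      by rewrite det_scalar prodr_const card_ord.
    by rewrite modulus_prod prodr_gt0// => i _; rewrite mc invr_gt0.
  apply: ub_le_sup; first by case: supE.
  exists (c%:M) => //= j; rewrite -scalemx1 linearZ /= (normlikeZ nv) mc.
  rewrite ler_pdivrMl// (le_trans (normlike_up nv _))// mulr1 -[leRHS]mulr1 ler_wpM2l ?(ltW C0)//.
  by rewrite colE mul1mx mnorm_delta.
have [_ [Y /= vY <-] EY] : exists2 e, E e & sup E / 2 < e.
  by have [e Ee] := sup_adherent (divr_gt0 E0 (ltr0Sn _ 1)) supE; exists e => //; lra.
have Y0 : \det Y != 0.
  by rewrite -modulus_eq0 gt_eqF// (lt_trans _ EY)// divr_gt0.
have uY : Y \in unitmx by rewrite unitmxE unitfE.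
exists Y; split=> // [x|x].
- have [vx0|vx0] := eqVneq (v x) 0.
    have -> : x = 0.
      by apply: mnorm_eq0; apply/eqP; rewrite eq_le mnorm_ge0 andbT -vx0 (normlike_low nv).
    by rewrite mulmx0 mnorm0 !mulr_ge0// (normlike_ge0 _ nv).
  have vx : 0 < v x by rewrite lt0r vx0 (normlike_ge0 _ nv).
  rewrite -mulrA -[d in leRHS]muln1; apply: mnorm_le => i j; rewrite {j}ord1.
  set c := invmx Y *m x; pose t := embed s (v x)^-1.
  have mt : modulus t = (v x)^-1 by rewrite modulus_embed ger0_norm// invr_ge0 ltW.
  (* Multiplying by Z on the right replaces column i of Y by x / v x. *)
  pose Z : 'M[K]_d := \matrix_(j, k) if k == i then t * c j 0 else (j == k)%:R.
  have detZ : \det Z = t * c i 0.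
    rewrite (expand_det_row _ i) (bigD1 i)//= big1 => [|k ki].
      rewrite addr0 mxE eqxx /cofactor -signr_odd addnn odd_double mul1r.
      rewrite (_ : row' i (col' i Z) = 1%:M) ?det1 ?mulr1//.
      apply/matrixP => j k; rewrite !mxE eq_sym (negbTE (neq_lift _ _)).
      by rewrite (inj_eq (@lift_inj _ i)).
    by rewrite mxE (negbTE ki) eq_sym (negbTE ki) mul0r.
  have : E (modulus (\det (Y *m Z))).
    exists (Y *m Z) => //= j; rewrite colE -mulmxA -colE.
    have [->|ji] := eqVneq j i.
      have -> : col i Z = t *: c by apply/matrixP => k l; rewrite !mxE eqxx ord1.
      rewrite -scalemxAr /c mulmxA mulmxV// mul1mx (normlikeZ nv) mt.
      by rewrite mulVf ?gt_eqF.
    have -> : col j Z = delta_mx j 0.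
      by apply/matrixP => k l; rewrite !mxE (negbTE ji) ord1 eqxx andbT.
    by rewrite -colE.
  move=> /(ub_le_sup (proj2 supE)); rewrite det_mulmx detZ !modulusM mt => H.
  have mY : 0 < modulus (\det Y) by rewrite lt0r modulus_eq0 Y0 modulus_ge0.
  have {}H : modulus (\det Y) * ((v x)^-1 * modulus (c i 0)) <= modulus (\det Y) * 2.
    by rewrite (le_trans H)// ltW// -ltr_pdivrMr.
  by move: H; rewrite ler_pM2l// ler_pdivrMl// mulrC.
- have -> : Y *m x = \sum_j x j 0 *: col j Y.
    apply/matrixP => i k; rewrite ord1 mxE summxE.
    by apply: eq_bigr => j _; rewrite !mxE mulrC.
  have vsum (I : Type) (r : seq I) (F : I -> 'cV[K]_d) :
      v (\sum_(i <- r) F i) <= \sum_(i <- r) v (F i).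
    elim/big_rec2: _ => [|i y z _ yz].
      by rewrite -(scale0r 0) (normlikeZ nv) modulus0 mul0r.
    by rewrite (le_trans (normlikeD nv _ _))// lerD2l.
  rewrite (le_trans (vsum _ _ _))//; apply: ler_sum => j _.
  by rewrite big_ord1 (normlikeZ nv) -[leRHS]mulr1 ler_wpM2l ?modulus_ge0.
Qed.

Lemma auerbach_conj v Y b A :
  (forall x, mnorm (invmx Y *m x) <= d%:R * 2 * v x) ->
  (forall x, v (Y *m x) <= mnorm x) ->
  0 <= b -> lip v b A -> mnorm (invmx Y *m A *m Y) <= (d ^ 2)%:R * 2 * b.
Proof.
move=> Y1 Y2 b0 Ab; rewrite /mnorm exchange_big /=.
rewrite natrX expr2 -2!mulrA [leRHS]mulr_natl -[d in leRHS]card_ord -sumr_const.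
apply: ler_sum => j _.
set Z := _ *m Y; have -> : \sum_i modulus (Z i j) = mnorm (Z *m delta_mx j 0 : 'cV[K]_d).
  by rewrite -colE /mnorm; apply: eq_bigr => i _; rewrite big_ord1 [in RHS]mxE.
rewrite -!mulmxA (le_trans (Y1 _))// card_ord mulrA ler_wpM2l//.
rewrite (le_trans (Ab _))// -[leRHS]mulr1 ler_wpM2l// (le_trans (Y2 _))//.
by rewrite mnorm_delta.
Qed.

End Words.

(** * Pivoting and Bochi's inequality *)

Section Pivoting.
Variables (R : realType) (s : scalar_kind).
Local Notation K := (base_field R s).

(** Gaussian elimination with complete pivoting has multipliers of modulus at
    most 1, so any matrix is diagonal up to factors that are bounded together
    with their inverses, by a constant depending on the dimension only. This
    is all that is needed of a singular value decomposition. *)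
Lemma bounded_diagonalization n : exists2 c : R, 0 < c &
  forall T : 'M[K]_n, exists (E E' F F' : 'M[K]_n) (D : 'rV[K]_n),
    [/\ E *m E' = 1%:M, F *m F' = 1%:M, T = E *m diag_mx D *m F &
      [/\ mnorm E <= c, mnorm E' <= c, mnorm F <= c & mnorm F' <= c]].
Proof.
elim: n => [|n [c c0 IH]].
  exists 1 => // T; exists 1%:M, 1%:M, 1%:M, 1%:M, 0.
  by rewrite mulmx1 mul1mx mnorm1 ler01 !flatmx0.
pose c2 := n.+1%:R * ((1 + 2 * n%:R) * (1 + c)) : R.
have n0 : 0 <= n%:R :> R by [].
have b0 : 1 <= 1 + 2 * n%:R :> R by lra.
have b1 : 1 <= (1 + 2 * n%:R) * (1 + c) by nra.
exists c2; first by rewrite mulr_gt0// (lt_le_trans _ b1).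
move=> T; have [T0|T0] := eqVneq T 0.
  have c2n : n.+1%:R <= c2 by rewrite -[leLHS]mulr1 /c2 ler_wpM2l.
  exists 1%:M, 1%:M, 1%:M, 1%:M, 0.
  by rewrite mnorm1 !mul1mx c2n T0 linear0 mulmx1.
pose p := [arg max_(p > (ord0, ord0) : 'I_n.+1 * 'I_n.+1) modulus (T p.1 p.2)]%O.
have Tp i j : modulus (T i j) <= modulus (T p.1 p.2).
  by rewrite /p; case: arg_maxP => // q _ /(_ (i, j)); exact.
pose P : 'M[K]_(n.+1) := perm_mx (tperm ord0 p.1).
pose Q : 'M[K]_(n.+1) := perm_mx (tperm ord0 p.2).
have PP : P *m P = 1%:M by rewrite -perm_mxM tperm2 perm_mx1.
have QQ : Q *m Q = 1%:M by rewrite -perm_mxM tperm2 perm_mx1.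
pose T1 : 'M[K]_(1 + n) := row_perm (tperm ord0 p.1) (col_perm (tperm ord0 p.2) T).
have T1E i j : T1 i j = T (tperm ord0 p.1 i) (tperm ord0 p.2 j) by rewrite !mxE.
have PTQ : T = P *m T1 *m Q.
  by rewrite /T1 row_permE col_permE tpermV !mulmxA PP mul1mx -mulmxA QQ mulmx1.
pose a := T1 0 0.
have aE : a = T p.1 p.2 by rewrite /a T1E !tpermL.
have a0 : a != 0.
  apply: contra T0 => /eqP a0; apply/eqP/matrixP => i j; rewrite mxE.
  apply/eqP; rewrite -modulus_eq0 eq_le modulus_ge0 andbT.
  by rewrite (le_trans (Tp i j))// -aE a0 modulus0.
have ma : 0 < modulus a by rewrite lt0r modulus_eq0 a0 modulus_ge0.
pose u := a^-1 *: dlsubmx T1; pose w := a^-1 *: ursubmx T1.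
have mu : mnorm u <= n%:R.
  rewrite -[leRHS]mulr1 -[n in leRHS]muln1; apply: mnorm_le => i j.
  by rewrite !mxE modulusM modulusV ler_pdivrMl// mulr1 aE Tp.
have mw : mnorm w <= n%:R.
  rewrite -[leRHS]mulr1 -[n in leRHS]mul1n; apply: mnorm_le => i j.
  by rewrite !mxE modulusM modulusV ler_pdivrMl// mulr1 aE Tp.
have [E [E' [F [F' [D [EE FF TE [mE mE' mF mF']]]]]]] := IH (drsubmx T1 - a *: (u *m w)).
pose L (y : 'cV[K]_n) : 'M[K]_(1 + n) := block_mx 1%:M 0 y 1%:M.
pose U (y : 'rV[K]_n) : 'M[K]_(1 + n) := block_mx 1%:M y 0 1%:M.
pose G (X : 'M[K]_n) : 'M[K]_(1 + n) := block_mx 1%:M 0 0 X.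
pose simpb := (mul0mx, mulmx0, addr0, add0r, mul1mx, mulmx1).
have T1D : T1 = L u *m G E *m diag_mx (row_mx (a%:M : 'rV_1) D) *m (G F *m U w).
  have T1a : ulsubmx T1 = a%:M.
    apply/matrixP => i j; rewrite !ord1 !mxE /= ?eqxx ?mulr1n aE.
    by rewrite (_ : lshift n 0 = ord0) ?tpermL//; apply/val_inj.
  rewrite /L /U /G diag_mx_row !mulmx_block !simpb.
  rewrite -{1}[T1]submxK T1a.
  have -> : diag_mx (a%:M : 'rV_1) = a%:M :> 'M[K]_1.
    by apply/matrixP => i j; rewrite !ord1 !mxE eqxx.
  rewrite mul_scalar_mx mul_mx_scalar !scalerA divff// !scale1r; congr block_mx.
  have -> : dlsubmx T1 = a *: u by rewrite scalerA divff// scale1r.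
  by rewrite -TE -scalemxAl addrC subrK.
have LL y : L y *m L (- y) = 1%:M.
  by rewrite /L mulmx_block !simpb subrr -scalar_mx_block.
have UU y : U y *m U (- y) = 1%:M.
  by rewrite /U mulmx_block !simpb addNr -scalar_mx_block.
have GG X X' : X *m X' = 1%:M -> G X *m G X' = 1%:M.
  by move=> XX; rewrite /G mulmx_block !simpb XX -scalar_mx_block.
have mL y : mnorm y <= n%:R -> mnorm (L y) <= 1 + 2 * n%:R.
  by move=> yn; rewrite /L /block_mx mnorm_col_mx !mnorm_row_mx mnorm0 !mnorm1; lra.
have mU y : mnorm y <= n%:R -> mnorm (U y) <= 1 + 2 * n%:R.
  by move=> yn; rewrite /U /block_mx mnorm_col_mx !mnorm_row_mx mnorm0 !mnorm1; lra.
have mG X : mnorm X <= c -> mnorm (G X) <= 1 + c.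
  by move=> Xc; rewrite /G /block_mx mnorm_col_mx !mnorm_row_mx !mnorm0 !mnorm1; lra.
have mP (sg : {perm 'I_n.+1}) : mnorm (perm_mx sg : 'M[K]_(1 + n)) <= n.+1%:R.
  by rewrite mnorm_perm.
exists (P *m (L u *m G E)), ((G E' *m L (- u)) *m P).
exists ((G F *m U w) *m Q), (Q *m (U (- w) *m G F')).
exists (row_mx (a%:M : 'rV_1) D); split.
- by rewrite -!mulmxA (mulmxA (G E)) GG// mul1mx (mulmxA (L u)) LL mul1mx.
- by rewrite -!mulmxA (mulmxA Q) QQ mul1mx (mulmxA (U w)) UU mul1mx GG.
- by rewrite PTQ T1D !mulmxA.
- split.
  + by apply: mnormM_le; first exact: mP; apply: mnormM_le; [exact: mL | exact: mG].
  + rewrite /c2 mulrC; apply: mnormM_le; last exact: mP; rewrite mulrC.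
    by apply: mnormM_le; [exact: mG | apply: mL; rewrite mnormN].
  + rewrite /c2 mulrC; apply: mnormM_le; last exact: mP; rewrite mulrC.
    by apply: mnormM_le; [exact: mG | exact: mU].
  + by apply: mnormM_le; first exact: mP; apply: mnormM_le; [apply: mU; rewrite mnormN | exact: mG].
Qed.

End Pivoting.

Section Bochi.
Variables (R : realType) (s : scalar_kind) (d : nat).
Local Notation K := (base_field R s).
Implicit Types (M : set 'M[K]_d) (A S : 'M[K]_d).

Lemma word_nonempty M k S : (0 < k)%N -> word M k S -> exists A, M A.
Proof. by case: k => // k _ [A MA _]; exists A. Qed.

(** The entries that increase the weight form matrices whose products of length
    [d] vanish, because there is no chain of [d+1] increasing weights. So each
    term of a product of [d] factors contains an entry bounded by [r]. *)
Lemma weighted_product M (G G' : 'M[K]_d) (om : 'I_d -> R) (a r : R) S :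
  (0 < d)%N -> G *m G' = 1%:M -> 0 <= r ->
  (forall A, M A -> mnorm (G *m A *m G') <= a) ->
  (forall A i j, M A -> om j <= om i -> modulus ((G *m A *m G') i j) <= r) ->
  word M d S ->
  mnorm (G *m S *m G') <= d%:R * ((d ^ 3)%:R * r * a ^+ d.-1).
Proof.
move=> d0 GG r0 Ma Mr wS.
have G'G : G' *m G = 1%:M by exact: mulmx1C.
have [A0 MA0] : exists A, M A.
  by apply: word_nonempty wS.
have a0 : 0 <= a by rewrite (le_trans (mnorm_ge0 _) (Ma _ MA0)).
have {A0 MA0} main k T : word M k T -> exists L : 'M[K]_d,
    [/\ mnorm (G *m T *m G') <= d%:R * a ^+ k,
        mnorm (G *m T *m G' - L) <= k%:R * ((d ^ 3)%:R * r * a ^+ k.-1)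
      & forall i j, L i j != 0 -> (k <= #|[pred l | (om i < om l)%R]|)%N].
  elim: k T => [T ->|k IH _ [A MA [T /IH[L [H1 H2 H3]] <-]]].
    by exists 1%:M; rewrite mulmx1 GG subrr mnorm0 mnorm1 mulr1 mul0r.
  have -> : G *m (A *m T) *m G' = (G *m A *m G') *m (G *m T *m G').
    by rewrite -!mulmxA (mulmxA G') G'G mul1mx.
  set B := G *m A *m G'; set V := G *m T *m G' in H1 H2 *.
  pose B1 : 'M[K]_d := \matrix_(i, j) if om i < om j then B i j else 0.
  have mB1 : mnorm B1 <= a.
    rewrite (le_trans _ (Ma _ MA))//; apply: ler_sum => i _; apply: ler_sum => j _.
    by rewrite mxE; case: ifP => // _; rewrite modulus0 modulus_ge0.
  have mBB : mnorm (B - B1) <= (d ^ 2)%:R * r.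
    rewrite expnS expn1; apply: mnorm_le => i j.
    rewrite [(B - B1) i j]mxE [(- B1) i j]mxE [B1 i j]mxE.
    case: ltP => [_|ij]; first by rewrite subrr modulus0.
    by rewrite subr0; exact: Mr.
  exists (B1 *m L); split.
  - by rewrite exprS mulrCA; apply: mnormM_le => //; exact: Ma.
  - have -> : B *m V - B1 *m L = (B - B1) *m V + B1 *m (V - L).
      by rewrite mulmxBl mulmxBr addrA subrK.
    rewrite (le_trans (mnormD _ _))// -natr1 mulrDl mul1r addrC lerD//.
      apply: (le_trans (mnormM_le mB1 H2)).
      case: k {IH H1 H2 H3 T V} => [|k]; first by rewrite !mul0r mulr0.
      by rewrite mulrCA ler_wpM2l//= mulrCA exprS.
    rewrite (le_trans (mnormM_le mBB H1))//= expnSr natrM.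
    by rewrite le_eqVlt; apply/orP; left; apply/eqP; ring.
  - move=> i j; rewrite mxE => /eqP H.
    have [l] : exists l, B1 i l * L l j != 0.
      apply/not_existsP => K0; apply: H; apply: big1 => l _; apply/eqP.
      by apply/negbNE/negP; exact: K0.
    rewrite mulf_eq0 negb_or mxE => /andP[]; case: ifP => [il _ /H3|]; last by rewrite eqxx.
    move=> /leq_ltn_trans; apply; apply: proper_card; apply/properP; split.
      by apply/fintype.subsetP => m; rewrite !inE => /(lt_trans il).
    by exists l; rewrite !inE ?ltxx.
have [L [_ H2 H3]] := main _ _ wS.
rewrite -[G *m S *m G'](subr0) -(_ : L = 0)//; apply/matrixP => i j; rewrite mxE.
apply/eqP/negPn/negP => /H3; rewrite leqNgt => /negP; apply.
rewrite -[X in (_ < X)%N]card_ord ; apply: proper_card; apply/properP.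
by split; [exact: fintype.subset_predT | exists i; rewrite !inE ?ltxx].
Qed.

(** This is Bochi's inequality. In a basis adapted to [v] and to the discounted
    norm for the rate [l], both are comparable to weighted maximum norms, with
    constants depending on [d] only. The entries that do not increase the ratio
    of the weights are then [O(l)], all others are [O(b)], and
    [weighted_product] applies. *)
Lemma bochi : (0 < d)%N -> exists2 c : R, 0 < c &
  forall M (C1 C : R) (v : 'cV[K]_d -> R) (b l : R), normlike C1 v -> 0 < C1 ->
    0 <= b -> (forall A, M A -> lip v b A) ->
    0 < l -> 0 < C -> wbound M l C ->
    forall S, word M d S -> lip v (c * l * b ^+ d.-1) S.
Proof.
move=> d0; have [q q0 diag] := bounded_diagonalization R s d.
pose q2 : R := (d ^ 2)%:R * 2 * q ^+ 2.
have d0R : 0 < d%:R :> R by rewrite ltr0n.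
have q20 : 0 < q2 by rewrite !mulr_gt0// ?exprn_gt0// ltr0n expn_gt0 d0.
exists (q ^+ 2 * (d%:R * (d ^ 3)%:R * q2 ^+ d) * (d%:R * 2)).
  by rewrite !mulr_gt0 ?exprn_gt0// ltr0n expn_gt0 d0.
move=> M C1 C v b l nv C10 b0 Mb l0 C0 wM S wS x.
have nw := adapted_normlike l0 wM.
have Ml A : M A -> lip (adapted M l) l A by exact: adapted_lip wM _.
have [Y [uY Y1 Y2]] := auerbach C10 nv.
have [X [uX X1 X2]] := auerbach C0 nw.
have [E [E' [F [F' [D [EE FF XY [mE mE' mF mF']]]]]]] := diag (invmx X *m Y).
have E'E := mulmx1C EE; have F'F := mulmx1C FF.
pose G := F *m invmx Y; pose G' := Y *m F'.
have GG : G *m G' = 1%:M by rewrite /G /G' mulmxA mulmxKV.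
have G'G := mulmx1C GG.
have D0 i : D 0 i != 0.
  have : invmx X *m Y \in unitmx by rewrite unitmx_mul unitmx_inv uX.
  rewrite XY !unitmx_mul => /andP[/andP[_]].
  by rewrite unitmxE det_diag unitfE => /prodf_neq0 /(_ i isT).
have qq A : mnorm A <= (d ^ 2)%:R * 2 * b -> mnorm (F *m A *m F') <= q2 * b.
  move=> Ab; have := mnormM_le (mnormM_le mF Ab) mF'.
  by rewrite /q2 => /le_trans; apply; rewrite le_eqVlt; apply/orP; left; apply/eqP; ring.
have GAG A : G *m A *m G' = F *m (invmx Y *m A *m Y) *m F' by rewrite /G /G' !mulmxA.
have H1 A : M A -> mnorm (G *m A *m G') <= q2 * b.
  by move=> MA; rewrite GAG; apply: qq; exact: auerbach_conj Y1 Y2 b0 (Mb A MA).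
have H2 A i j : M A -> modulus (D 0 j) <= modulus (D 0 i) ->
    modulus ((G *m A *m G') i j) <= q2 * l.
  move=> MA ji; set Z := E' *m (invmx X *m A *m X) *m E.
  (* The diagonal factor is moved across rather than inverted. *)
  have ZD : diag_mx D *m (G *m A *m G') = Z *m diag_mx D.
    have XAY : invmx X *m A *m X *m (E *m diag_mx D *m F) =
        E *m diag_mx D *m F *m (invmx Y *m A *m Y).
      by rewrite -XY -!mulmxA (mulmxA X) mulmxV// mul1mx (mulmxA Y) mulmxV// mul1mx.
    rewrite GAG -[diag_mx D in LHS]mul1mx -E'E -(mulmxA E') -(mulmxA E') (mulmxA (E *m _)).
    rewrite (mulmxA (E *m _)) -XAY -!mulmxA FF mulmx1.
    by rewrite /Z !mulmxA.
  have mD : 0 < modulus (D 0 i) by rewrite lt0r modulus_eq0 D0 modulus_ge0.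
  have mZ : modulus (Z i j) <= q2 * l.
    rewrite (le_trans (modulus_le_mnorm _ _ _))//.
    have := mnormM_le (mnormM_le mE' (auerbach_conj X1 X2 (ltW l0) (Ml A MA))) mE.
    by move=> /le_trans; apply; rewrite le_eqVlt; apply/orP; left; apply/eqP; rewrite /q2; ring.
  move/matrixP: ZD => /(_ i j); rewrite mul_diag_mx mul_mx_diag [LHS]mxE [RHS]mxE.
  move=> /(congr1 (@modulus R s)); rewrite !modulusM => ZD.
  by rewrite -(ler_pM2l mD) ZD mulrC; apply: ler_pM; rewrite ?modulus_ge0.
have q2l : 0 <= q2 * l by rewrite ltW// mulr_gt0.
have wP := weighted_product d0 GG q2l H1 H2 wS.
have -> : S *m x = Y *m (F' *m (G *m S *m G') *m (F *m (invmx Y *m x))).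
  transitivity (G' *m G *m S *m (G' *m G) *m x); first by rewrite G'G mul1mx mulmx1.
  by rewrite /G' /G !mulmxA.
rewrite (le_trans (Y2 _))//.
apply: (le_trans (mnormM_le (mnormM_le mF' wP) (mnormM_le mF (Y1 x)))).
have q2d : q2 ^+ d = q2 * q2 ^+ d.-1 by rewrite -exprS prednK.
rewrite q2d exprMn le_eqVlt; apply/orP; left; apply/eqP.
by move: (q2 ^+ d.-1) (b ^+ d.-1) ((d ^ 3)%:R : R) (d%:R : R) (v x); clear => *; ring.
Qed.

End Bochi.

(** * Polynomial growth at the critical rate *)

Section Elementary.
Variable R : realType.
Implicit Types x t a c : R.

Lemma bernoulli_ge x n : -1 <= x -> 1 + n%:R * x <= (1 + x) ^+ n.
Proof.
move=> x1; elim: n => [|n IH]; first by rewrite mul0r addr0 expr0.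
have n0 : 0 <= n%:R :> R by [].
have x0 : 0 <= 1 + x by lra.
rewrite exprS (le_trans _ (ler_wpM2l x0 IH))// -natr1.
have : 0 <= n%:R * x ^+ 2 by rewrite mulr_ge0// sqr_ge0.
by rewrite expr2; nra.
Qed.

(** The chord of the convex function [(1 + t) ^ n] over the unit interval. *)
Lemma expr1D_le t n : 0 <= t <= 1 -> (1 + t) ^+ n <= 1 + (2 ^+ n - 1) * t.
Proof.
move=> /andP[t0 t1]; elim: n => [|n IH]; first by rewrite !expr0 subrr mul0r addr0.
have e0 : 1 <= 2 ^+ n :> R by rewrite exprn_ege1// ler1n.
rewrite exprSr (le_trans (ler_wpM2r _ IH)) ?addr_ge0//.
rewrite [2 ^+ n.+1]exprS; move: (2 ^+ n) e0 => e e0.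
have : 0 <= (e - 1) * (t * (1 - t)) by rewrite !mulr_ge0//; lra.
by nra.
Qed.

Lemma le0_eps a c : 0 <= c -> (forall e, 0 < e -> a <= e * c) -> a <= 0.
Proof.
move=> c0 H; rewrite leNgt; apply/negP => a0.
have c1 : 0 < c + 1 by lra.
have := H (a / (c + 1)) (divr_gt0 a0 c1).
by rewrite mulrAC ler_pdivlMr// leNgt => /negP; apply; nra.
Qed.

Lemma geometric_unbounded (q C : R) : 1 < q -> ~ (forall n, q ^+ n <= C).
Proof.
move=> q1 H; have q0 : 0 < q - 1 by lra.
pose n := (Num.truncn (C / (q - 1))).+1.
have : C < n%:R * (q - 1) by rewrite -ltr_pdivrMr// truncnS_gt.
have := H n; have := @bernoulli_ge (q - 1) n.
have -> : 1 + (q - 1) = q by lra.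
move=> B1 B2.
by have := le_trans (B1 ltac:(lra)) B2; lra.
Qed.

End Elementary.

Section Growth.
Variables (R : realType) (s : scalar_kind) (d : nat).
Local Notation K := (base_field R s).
Implicit Types (M N : set 'M[K]_d) (A S T Q : 'M[K]_d).

(** Otherwise, by compactness of the unit sphere of the fixed space of [Q], there
    would be a length within which every vector of this space can be doubled
    in norm, and repeated doubling is exponential growth. *)
Lemma bounded_orbit N Q : Q != 0 -> Q *m Q = Q ->
  (forall A, N A -> Q *m A *m Q = Q *m A) ->
  (forall l : R, 1 < l -> exists2 C, 0 <= C & 
    forall k T, word N k T -> mnorm (Q *m T) <= C * l ^+ k) ->
  exists (x : 'rV[K]_d) (B : R), [/\ x != 0, x *m Q = x &
    forall k T, word N k T -> mnorm (x *m T) <= B].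
Proof.
move=> Q0 QQ QN sub.
have QW k T : word N k T -> Q *m T *m Q = Q *m T.
  elim: k T => [T ->|k IH _ [A NA [T /IH TQ <-]]]; first by rewrite mulmx1.
  by rewrite mulmxA -(QN A NA) -!mulmxA (mulmxA Q T) TQ.
have [[L HL]|nL] := pselect (exists L, forall x : 'rV[K]_d, x *m Q = x ->
   exists k T, [/\ (k <= L)%N, word N k T & 2 * mnorm x <= mnorm (x *m T)]).
  exfalso.
  have [x0 [x00 x0Q]] : exists x0 : 'rV[K]_d, x0 != 0 /\ x0 *m Q = x0.
    have [i Qi] : exists i, row i Q != 0.
      apply/not_existsP => H; move/negP: Q0; apply; apply/eqP/row_matrixP => i.
      by rewrite row0; apply/eqP/negPn/negP; exact: H.
    by exists (row i Q); rewrite -row_mul QQ.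
  have mx0 : 0 < mnorm x0.
    rewrite lt0r mnorm_ge0 andbT; apply: contra x00 => /eqP/mnorm_eq0 ->.
    exact: eqxx.
  have dbl n : exists k T, [/\ (k <= n * L)%N, word N k T & 
      2 ^+ n * mnorm x0 <= mnorm (x0 *m T)].
    elim: n => [|n [k [T [kn wT xT]]]].
      by exists 0%N, 1%:M; rewrite mulmx1 expr0 mul1r.
    have [|k' [T' [k'L wT' xT']]] := HL (x0 *m T).
      by rewrite -{1}x0Q -!mulmxA (mulmxA Q) (QW _ _ wT) !mulmxA x0Q.
    exists (k + k')%N, (T *m T'); split; first by rewrite mulSn addnC leq_add.
      exact: wordD.
    by rewrite mulmxA (le_trans _ xT')// exprS -mulrA ler_wpM2l.
  (* A rate so close to 1 that L steps multiply norms by at most 3/2 < 2. *)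
  pose t : R := (2 * 2 ^+ L)^-1.
  have e1 : 1 <= 2 ^+ L :> R by rewrite exprn_ege1// ler1n.
  have t0 : 0 < t by rewrite invr_gt0; lra.
  have tL : 2 ^+ L * t = 2^-1 by rewrite /t invfM mulrCA divff ?mulr1// gt_eqF//; lra.
  have t1 : t <= 1 by rewrite invf_le1; lra.
  have lL : (1 + t) ^+ L <= 3 / 2.
    by rewrite (le_trans (expr1D_le L _)) ?(ltW t0)// mulrBl tL mul1r; lra.
  have [|C C0 HC] := sub (1 + t); first by lra.
  have q1 : 1 < 4 / 3 :> R by lra.
  apply: (geometric_unbounded q1 (C := C)) => n.
  have [k [T [kn wT xT]]] := dbl n.
  have H1 : mnorm (x0 *m T) <= mnorm x0 * (C * (3 / 2) ^+ n).
    rewrite -{1}x0Q -mulmxA; apply: mnormM_le => //.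
    rewrite (le_trans (HC _ _ wT))// ler_wpM2l//.
    apply: (@le_trans _ _ ((1 + t) ^+ (n * L))).
      by rewrite ler_weXn2l//; lra.
    by rewrite mulnC exprM lerXn2r ?nnegrE ?exprn_ge0//; lra.
  have := le_trans xT H1; rewrite mulrC ler_pM2l//.
  have -> : 2 ^+ n = (4 / 3) ^+ n * (3 / 2) ^+ n :> R.
    by rewrite -exprMn; congr (_ ^+ n); lra.
  by rewrite ler_pM2r// exprn_gt0//; lra.
have /choice[x Hx] : forall L, exists x : 'rV[K]_d, [/\ mnorm x = 1, x *m Q = x &
    forall k T, (k <= L)%N -> word N k T -> mnorm (x *m T) <= 2].
  move=> L; apply: contrapT => H; apply: nL; exists L => x xQ.
  have [->|x0] := eqVneq x 0.
    by exists 0%N, 1%:M; rewrite mulmx1 mnorm0 mulr0.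
  apply: contrapT => H2; apply: H.
  have mx0 : 0 < mnorm x.
    rewrite lt0r mnorm_ge0 andbT; apply: contra x0 => /eqP/mnorm_eq0 ->.
    exact: eqxx.
  have mc : modulus (embed s (mnorm x)^-1) = (mnorm x)^-1.
    by rewrite modulus_embed ger0_norm// invr_ge0 ltW.
  exists (embed s (mnorm x)^-1 *: x); split.
  - by rewrite mnormZ mc mulVf// gt_eqF.
  - by rewrite -scalemxAl xQ.
  - move=> k T kL wT; rewrite -scalemxAl mnormZ mc ler_pdivrMl// mulrC leNgt.
    by apply/negP => /ltW ?; apply: H2; exists k, T.
have [|y Hy] := @bounded_rV_cluster R s d x 1.
  by move=> k; have [->] := Hx k.
exists y, 2; split.
- apply/eqP => y0; have [|k _] := Hy (1 / 2) 0%N; first by lra.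
  by rewrite y0 subr0; have [-> _ _] := Hx k; lra.
- apply/eqP; rewrite -subr_eq0; apply/eqP/mnorm_eq0/eqP; rewrite eq_le mnorm_ge0 andbT.
  apply: (@le0_eps _ _ (mnorm Q + 1)) => [|e e0]; first by rewrite addr_ge0// mnorm_ge0.
  have [k _ xy] := Hy e 0%N e0.
  have -> : y *m Q - y = (x k - y) - (x k - y) *m Q.
    have [_ xQ _] := Hx k; rewrite mulmxBl xQ.
    by rewrite opprB [RHS]addrC [RHS]addrA subrK.
  rewrite (le_trans (mnormD _ _))// mnormN mulrDr mulr1 addrC lerD//.
  exact: mnormM_le.
- move=> k T wT; rewrite -subr_le0.
  apply: (@le0_eps _ _ (mnorm T)) => [|e e0]; first exact: mnorm_ge0.
  have [j kj xy] := Hy e k e0.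
  have [_ _ /(_ k T kj wT) xT] := Hx j.
  have -> : y *m T = x j *m T - (x j - y) *m T by rewrite mulmxBl opprB addrC subrK.
  rewrite lerBlDr addrC (le_trans (mnormD _ _))// mnormN lerD//.
  exact: mnormM_le.
Qed.

(** The index is shifted by one to start an induction on the dimension at the
    zero subspace, whose orbits vanish. *)
Definition poly_growth p k : R := if p is p'.+1 then k.+1%:R ^+ p' else 0.

Lemma poly_growth_ge0 p k : 0 <= poly_growth p k.
Proof. by case: p => //= p; rewrite exprn_ge0. Qed.

Lemma poly_growthS p k : poly_growth p k.+1 <= 2 ^+ p * poly_growth p k.
Proof.
case: p => [|p] /=; first by rewrite mulr0.
rewrite exprS -mulrA -exprMn; apply: (@le_trans _ _ ((2 * k.+1%:R) ^+ p)).
  by rewrite lerXn2r ?nnegrE// -natrM ler_nat mul2n -addnn addnS ltnS leq_addr.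
by rewrite ler_peMl ?ler1n// exprn_ge0.
Qed.

Lemma poly_growth_mono p k l : (k <= l)%N -> poly_growth p k <= poly_growth p l.
Proof. by case: p => //= p kl; rewrite lerXn2r ?nnegrE// ler_nat ltnS. Qed.

Lemma poly_growth_sum p k (B D : R) : 0 <= B -> 0 <= D ->
  B + k%:R * (D * poly_growth p k) <= (B + D) * poly_growth p.+1 k.
Proof.
move=> B0 D0; case: p => [|p] /=; first by rewrite expr0 !mulr0 addr0 mulr1 lerDl.
have e1 : 1 <= k.+1%:R ^+ p.+1 :> R by rewrite exprn_ege1// ler1n.
rewrite mulrDl lerD//; first by rewrite -[leLHS]mulr1 ler_wpM2l.
rewrite mulrCA ler_wpM2l// exprS ler_wpM2r ?exprn_ge0// ler_nat.
exact: leqnSn.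
Qed.

Definition growth_class M p m (U : 'M[K]_(m, d)) :=
  exists2 C : R, 0 <= C & forall k S, word M k S -> mnorm (U *m S) <= C * poly_growth p k.

Lemma growth_class_sub M p m n (U : 'M[K]_(m, d)) (V : 'M[K]_(n, d)) :
  (V <= U)%MS -> growth_class M p U -> growth_class M p V.
Proof.
move=> /submxP[X ->] [C C0 HC]; exists (mnorm X * C) => [|k S wS].
  by rewrite mulr_ge0// mnorm_ge0.
by rewrite -mulmxA -mulrA; apply: mnormM_le => //; exact: HC.
Qed.

Lemma growth_class_adds M p m n (U : 'M[K]_(m, d)) (V : 'M[K]_(n, d)) :
  growth_class M p U -> growth_class M p V -> growth_class M p (U + V)%MS.
Proof.
move=> [C C0 HC] [E E0 HE].
apply: (@growth_class_sub _ _ _ _ (col_mx U V)); first by rewrite addsmxE.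
exists (C + E) => [|k S wS]; first by rewrite addr_ge0.
by rewrite mul_col_mx mnorm_col_mx mulrDl lerD; [|exact: HC|exact: HE].
Qed.

Lemma growth_class_mul M p m (U : 'M[K]_(m, d)) A :
  M A -> growth_class M p U -> growth_class M p (U *m A).
Proof.
move=> MA [C C0 HC]; exists (C * 2 ^+ p) => [|k S wS].
  by rewrite mulr_ge0// exprn_ge0.
rewrite -mulmxA (le_trans (HC k.+1 _ _))//; first by exists A => //; exists S.
by rewrite -mulrA ler_wpM2l// poly_growthS.
Qed.

Lemma growth_class_max M p : exists2 U : 'M[K]_d, growth_class M p U &
  forall m (V : 'M[K]_(m, d)), growth_class M p V -> (V <= U)%MS.
Proof.
pose P r := `[< exists2 U : 'M[K]_d, growth_class M p U & \rank U = r >].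
have exP : exists r, P r.
  exists 0%N; apply/asboolP; exists 0; last by rewrite mxrank0.
  by exists 0 => // k S _; rewrite mul0mx mnorm0 mul0r.
have ubP r : P r -> (r <= d)%N by move=> /asboolP[U _ <-]; exact: rank_leq_row.
case: (ex_maxnP exP ubP) => r /asboolP[U HU rU] maxr.
exists U => // m V HV.
have /mxrank_leqif_sup H := addsmxSl U V.
have : (\rank (U + V)%MS <= \rank U)%N.
  rewrite rU; apply: maxr; apply/asboolP; exists (U + V)%MS => //.
  exact: growth_class_adds.
by rewrite (geq_leqif H); apply: submx_trans; exact: addsmxSr.
Qed.

(** The subspace of the vectors whose orbits grow at most like [k^(p-1)] is
    invariant. Modulo this subspace some vector has a bounded orbit; the
    components of its orbit in the subspace add up to growth of the next order.
    So each order of growth adds a dimension. *)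
Lemma growth_class_rank M c p : 0 <= c -> mbounded M c ->
  (forall l : R, 1 < l -> exists2 C, 0 <= C & wbound M l C) ->
  (p <= d)%N -> exists2 U : 'M[K]_d, growth_class M p U & (p <= \rank U)%N.
Proof.
move=> c0 Mc sub; elim: p => [_|p IH pd].
  by have [U HU _] := growth_class_max M 0; exists U.
have [U HU maxU] := growth_class_max M p.
have pU : (p <= \rank U)%N.
  by have [V /maxU/mxrankS VU pV] := IH (ltnW pd); exact: leq_trans VU.
have UA A : M A -> (U *m A <= U)%MS by move=> MA; apply: maxU; exact: growth_class_mul.
have growS m (V : 'M[K]_(m, d)) : growth_class M p V -> growth_class M p.+1 V.
  move=> [C C0 HC]; exists C => // k S wS; rewrite (le_trans (HC _ _ wS))// ler_wpM2l//.
  have := @poly_growth_sum p k 0 1 (lexx 0) ler01.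
  case: (k) => [|k']; last first.
    by rewrite !add0r !mul1r; apply: le_trans; rewrite ler_peMl ?ler1n ?poly_growth_ge0.
  by case: (p) => //= p'; rewrite !expr1n.
have [dU|dU] := leqP p.+1 (\rank U); first by exists U => //; exact: growS.
pose P := proj_mx U (U^C)%MS; pose Q := proj_mx (U^C)%MS U.
have UC0 : (U :&: U^C)%MS = 0 by exact: capmx_compl.
have CU0 : (U^C :&: U)%MS = 0 by rewrite capmxC.
have PQ : P + Q = 1%:M.
  rewrite -[P]mul1mx -[Q]mul1mx; apply: add_proj_mx => //.
  by rewrite submx_full// addsmx_compl_full.
have PU m (V : 'M[K]_(m, d)) : (V *m P <= U)%MS by exact: proj_mx_sub.
have UQ m (V : 'M[K]_(m, d)) : (V <= U)%MS -> V *m Q = 0 by exact: proj_mx_0.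
clearbody P Q.
have QQ : Q *m Q = Q.
  have /(congr1 (fun X => X *m Q)) := PQ; rewrite mulmxDl mul1mx.
  by rewrite -[P]mul1mx (UQ _ (1%:M *m P)) ?PU// add0r.
have US k S : word M k S -> (U *m S <= U)%MS.
  elim: k S => [S ->|k IHk _ [A MA [S /IHk SU <-]]]; first by rewrite mulmx1.
  by rewrite mulmxA (submx_trans (submxMr S (UA A MA))).
have QSQ k S : word M k S -> Q *m S *m Q = S *m Q.
  move=> wS; rewrite -[in RHS](mul1mx S) -PQ mulmxDl mulmxDl.
  rewrite (UQ _ (P *m S)) ?add0r//.
  by rewrite (submx_trans _ (US _ _ wS))// submxMr// -[P]mul1mx PU.
have QA A : M A -> Q *m A *m Q = A *m Q.
  by move=> MA; apply: (QSQ 1%N); rewrite word1.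
have Q0 : Q != 0.
  apply/eqP => Q0; move: dU; rewrite ltnS leqNgt => /negP; apply.
  rewrite (leq_trans pd)// -[X in (X <= _)%N](mxrank1 K d) mxrankS//.
  by rewrite -PQ Q0 addr0 -[P]mul1mx PU.
(* N is the action of M on the quotient by U, on the complement of U. *)
pose N := [set A *m Q | A in M].
have NW k T : word N k T -> exists2 S, word M k S & T *m Q = S *m Q.
  elim: k T => [T ->|k IHk _ [_ [A MA <-] [T /IHk[S wS TS] <-]]]; first by exists 1%:M.
  exists (A *m S); first by exists A => //; exists S.
  by rewrite -!mulmxA TS (mulmxA Q) (QSQ _ _ wS).
have QN A : N A -> Q *m A *m Q = Q *m A.
  by move=> [B MB <-]; rewrite -!mulmxA QQ.
have QNW k T : word N k T -> Q *m T *m Q = Q *m T.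
  elim: k T => [T ->|k IHk _ [A NA [T /IHk TQ <-]]]; first by rewrite mulmx1.
  by rewrite mulmxA -(QN A NA) -!mulmxA (mulmxA Q T) TQ.
have [l l1|x [B [x0 xQ xB]]] := bounded_orbit Q0 QQ QN.
  have [C C0 HC] := sub l l1; exists (mnorm Q * C * mnorm Q).
    by rewrite !mulr_ge0 ?mnorm_ge0.
  move=> k T wT; have [S wS TS] := NW _ _ wT.
  rewrite -(QNW _ _ wT) -mulmxA TS mulmxA mulrAC.
  apply: mnormM_le => //; rewrite -mulrA; apply: mnormM_le => //; exact: HC.
have B0 : 0 <= B by rewrite (le_trans (mnorm_ge0 _) (xB 0%N 1%:M erefl)).
exists (U + x)%MS; last first.
  rewrite (leq_ltn_trans pU)// ltnNge; apply/negP.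
  rewrite (geq_leqif (mxrank_leqif_sup (addsmxSl U x))) addsmx_sub => /andP[_].
  by move=> /UQ; rewrite xQ => /eqP; apply/negP.
apply: growth_class_adds; first exact: growS.
have [C C0 HC] := HU.
have /submxP[X PX] : (P <= U)%MS by rewrite -[P]mul1mx PU.
pose D := B * c * mnorm X * C.
have D0 : 0 <= D by rewrite !mulr_ge0 ?mnorm_ge0.
exists (B + D); first by rewrite addr_ge0.
move=> k S wS; rewrite (le_trans _ (poly_growth_sum p k B0 D0))//.
elim: k S wS x {x0} xQ xB => [S -> x xQ xB|k IHk _ [A MA [S wS <-]] x xQ xB].
  by rewrite mul0r addr0; exact: (xB 0%N).
have xAE : x *m (A *m S) = x *m A *m X *m (U *m S) + x *m (A *m Q) *m S.
  rewrite -[A in LHS]mulmx1 -PQ mulmxDr mulmxDl mulmxDr PX.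
  by rewrite !mulmxA.
have xb : mnorm x <= B by have := xB 0%N 1%:M erefl; rewrite mulmx1.
rewrite xAE (le_trans (mnormD _ _))// -natr1 mulrDl mul1r addrA addrC lerD//.
  have H : mnorm (x *m A *m X) <= B * c * mnorm X.
    by apply: mnormM_le => //; apply: mnormM_le => //; exact: Mc.
  apply: (le_trans (mnormM_le H (HC _ _ wS))).
  by rewrite mulrA ler_wpM2l// poly_growth_mono.
apply: (@le_trans _ _ (B + k%:R * (D * poly_growth p k))).
  apply: IHk => //; first by rewrite -!mulmxA QQ.
  move=> j T wT; rewrite -mulmxA; apply: (xB j.+1).
  by exists (A *m Q); [exists A | exists T].
by rewrite lerD2l !ler_wpM2l// poly_growth_mono.
Qed.

Lemma polynomial_growth M c : (0 < d)%N -> 0 <= c -> mbounded M c ->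
  (forall l : R, 1 < l -> exists2 C, 0 <= C & wbound M l C) ->
  exists2 C, 0 <= C & forall k S, word M k S -> mnorm S <= C * k.+1%:R ^+ d.-1.
Proof.
move=> d0 c0 Mc sub.
have [U [C C0 HC] dU] := growth_class_rank c0 Mc sub (leqnn d).
have uU : U \in unitmx by rewrite -row_full_unit /row_full eqn_leq dU rank_leq_row.
exists (mnorm (invmx U) * C) => [|k S wS]; first by rewrite mulr_ge0 ?mnorm_ge0.
rewrite -[S](mulKmx uU) -mulrA; apply: mnormM_le => //.
have pE n : (0 < n)%N -> poly_growth n k = k.+1%:R ^+ n.-1 by case: n.
by rewrite -pE//; exact: HC.
Qed.

End Growth.

(** * The joint spectral radius as a critical rate *)

Section SpectralRadius.
Variables (R : realType) (s : scalar_kind) (d : nat).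
Local Notation K := (base_field R s).
Implicit Types (M : compacts R s d) (A S : 'M[K]_d).

Lemma euclidean_norm_le (x : 'cV[K]_d) : euclidean_norm x <= mnorm x.
Proof.
rewrite -[leRHS]ger0_norm ?mnorm_ge0// -sqrtr_sqr ler_wsqrtr//.
rewrite expr2 {1}/mnorm mulr_suml; apply: ler_sum => i _.
rewrite big_ord1 expr2 ler_wpM2l ?modulus_ge0//; exact: modulus_le_mnorm.
Qed.

Lemma modulus_le_euclidean (x : 'cV[K]_d) i : modulus (x i ord0) <= euclidean_norm x.
Proof.
rewrite -[leLHS]ger0_norm ?modulus_ge0// -sqrtr_sqr ler_wsqrtr//.
by rewrite (bigD1 i)//= lerDl sumr_ge0// => j _; rewrite sqr_ge0.
Qed.

Lemma mnorm_mul_unit A (x : 'cV[K]_d) : euclidean_norm x <= 1 -> mnorm (A *m x) <= mnorm A.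
Proof.
move=> x1; apply: ler_sum => i _; rewrite big_ord1 mxE (le_trans (modulus_sum _ _ _))//.
apply: ler_sum => j _; rewrite modulusM -[leRHS]mulr1 ler_wpM2l ?modulus_ge0//.
exact: le_trans (modulus_le_euclidean _ _) x1.
Qed.

Lemma spectral_norm_has_ub A :
  ubound [set euclidean_norm (A *m x) | x in [set x | euclidean_norm x <= 1]] (mnorm A).
Proof.
move=> _ [x /= x1 <-]; apply: le_trans (euclidean_norm_le _) _.
exact: mnorm_mul_unit.
Qed.

Lemma euclidean_norm0 : euclidean_norm (0 : 'cV[K]_d) = 0.
Proof.
apply/eqP; rewrite eq_le sqrtr_ge0 andbT (le_trans (euclidean_norm_le _))//.
by rewrite mnorm0.
Qed.

Lemma spectral_norm_le A : spectral_norm A <= mnorm A.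
Proof.
apply: ge_sup; last exact: spectral_norm_has_ub.
by exists (euclidean_norm (A *m 0)), 0 => //=; rewrite euclidean_norm0.
Qed.

Lemma spectral_norm_ge A (x : 'cV[K]_d) : euclidean_norm x <= 1 ->
  euclidean_norm (A *m x) <= spectral_norm A.
Proof.
move=> x1; apply: ub_le_sup; last by exists x.
by exists (mnorm A); exact: spectral_norm_has_ub.
Qed.

Lemma spectral_norm_ge0 A : 0 <= spectral_norm A.
Proof.
have := @spectral_norm_ge A 0; rewrite mulmx0 euclidean_norm0; exact.
Qed.

Lemma mnorm_le_spectral A : mnorm A <= (d * d)%:R * spectral_norm A.
Proof.
apply: mnorm_le => i j; pose e : 'cV[K]_d := delta_mx j 0.
have -> : A i j = (A *m e) i ord0 by rewrite -colE mxE.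
rewrite (le_trans (modulus_le_euclidean _ _))// spectral_norm_ge//.
by rewrite (le_trans (euclidean_norm_le _))// mnorm_delta.
Qed.

Lemma products_word k M : products k M = word (carrier M) k.
Proof.
elim: k => [|k IH]; apply/seteqP; split=> S.
- by move=> [A _ <-]; rewrite big_ord0.
- move=> ->; exists (fun=> 0) => [[]//|]; by rewrite big_ord0.
- move=> [A /= HA <-]; rewrite big_ord_recl /=.
  exists (A (rev_ord ord0)); first exact: HA.
  exists (\big[mulmx/1%:M]_(j < k) A (rev_ord (lift ord0 j))) => //.
  rewrite -IH; exists (fun i => A (widen_ord (leqnSn k) i)) => [i|]; first exact: HA.
  by apply: eq_bigr => j _; congr (A _); apply/val_inj; rewrite /= /bump/= add1n subSS.
- move=> [B MB [T wT <-]].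
  have [A /= HA <-] : products k M T by rewrite IH.
  exists (fun i => oapp A B (unlift ord_max i)) => [i /=|].
    by case: (unlift ord_max i) => //= j; exact: HA.
  rewrite big_ord_recl /=.
  have -> : rev_ord (ord0 : 'I_k.+1) = ord_max by apply/val_inj; rewrite /= subn1.
  rewrite unlift_none /=; congr (_ *m _); apply: eq_bigr => j _.
  have -> : rev_ord (lift ord0 j) = lift ord_max (rev_ord j).
    apply/val_inj; rewrite /= /bump/= add1n subSS leqNgt.
    by rewrite ltn_subrL (leq_trans _ (ltn_ord j)).
  by rewrite liftK.
Qed.

(** The joint spectral radius as the critical exponential rate of the products;
    this is independent of the norm and also makes sense for sets that are
    only bounded. *)
Definition is_rate (N : set 'M[K]_d) (r : R) :=
  [/\ 0 <= r, forall l, r < l -> exists2 C, 0 < C & wbound N l C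
    & forall l C, 0 < l -> wbound N l C -> r <= l].

Lemma eventually_geometric (q C : R) : 1 < q -> exists k0, forall k, (k0 <= k)%N -> C <= q ^+ k.
Proof.
move=> q1; apply: contrapT => H; apply: (geometric_unbounded q1 (C := C)) => n.
rewrite leNgt; apply/negP => Cn; apply: H; exists n => k nk.
by rewrite (le_trans (ltW Cn))// ler_eXn2l.
Qed.

Lemma wbound_le (N : set 'M[K]_d) l l' C C' : 0 <= l -> l <= l' -> 0 <= C' -> C <= C' ->
  wbound N l C -> wbound N l' C'.
Proof.
move=> l0 ll C0 CC HN k S wS; rewrite (le_trans (HN k S wS))//.
rewrite (@le_trans _ _ (C' * l ^+ k))//; first by rewrite ler_wpM2r// exprn_ge0.
by rewrite ler_wpM2l// lerXn2r// nnegrE (le_trans l0).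
Qed.

Lemma carrier_mbounded M : exists2 c, 0 < c & mbounded (carrier M) c.
Proof. by apply: compact_mnorm_bounded; case: M => ? []. Qed.

Lemma word_carrier M k : exists S, word (carrier M) k S.
Proof.
elim: k => [|k [S wS]]; first by exists 1%:M.
by case: M S wS => N [[A NA] cN] S wS; exists (A *m S), A => //; exists S.
Qed.

Lemma powR_inv_le (a x : R) k : (0 < k)%N -> 0 <= a -> 0 <= x ->
  (a `^ k%:R^-1 <= x) = (a <= x ^+ k).
Proof.
move=> k0 a0 x0.
have k0R : k%:R != 0 :> R by rewrite pnatr_eq0 -lt0n.
have e : (a `^ k%:R^-1) ^+ k = a.
  by rewrite -powR_mulrn ?powR_ge0// -powRrM mulVf// powRr1.
by rewrite -[in RHS]e ler_pXn2r// ?nnegrE ?powR_ge0.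
Qed.

(** Fekete's argument: if the supremum over one length [k] were below [l ^+ k]
    with [l] below the critical rate, then [wbound_of_length] would give a
    smaller rate. The factor between the spectral and the entry norm
    disappears with the [k]-th root. *)
Lemma joint_spectral_radius_rate M : is_rate (carrier M) (joint_spectral_radius M).
Proof.
have [c c0 Mc] := carrier_mbounded M.
pose E := [set l : R | 0 < l /\ exists C, wbound (carrier M) l C].
have cE : E c.
  by split=> //; exists d%:R => k S; apply: word_mnorm => //; exact: ltW.
have infE : has_inf E by split; [exists c | exists 0 => l [/ltW]].
set r := inf E.
have r0 : 0 <= r by apply: lb_le_inf; [exists c | move=> l [/ltW]].
have rate1 l : r < l -> exists2 C, 0 < C & wbound (carrier M) l C.
  move=> rl; have rl0 : 0 < l - r by lra.
  have [l' [l'0 [C HC]] l'l] := inf_adherent rl0 infE.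
  exists (`|C| + 1); first by rewrite ltr_wpDl.
  apply: wbound_le HC; [exact: ltW| | |].
  - by apply: ltW; move: l'l; rewrite -/r addrC subrK.
  - by rewrite addr_ge0.
  - by rewrite (le_trans (ler_norm C))// lerDl.
have rate2 l C : 0 < l -> wbound (carrier M) l C -> r <= l.
  move=> l0 HC; apply: ge_inf; first by case: infE.
  by split=> //; exists C.
suff -> : joint_spectral_radius M = r by [].
pose a k := sup [set spectral_norm S | S in products k M].
have aub k : has_ubound [set spectral_norm S | S in products k M].
  exists (d%:R * c ^+ k) => _ [S wS <-]; rewrite (le_trans (spectral_norm_le _))//.
  by move: wS; rewrite products_word; apply: word_mnorm => //; exact: ltW.
have a_ge k S : word (carrier M) k S -> spectral_norm S <= a k.
  by move=> wS; apply: ub_le_sup => //; exists S => //; rewrite products_word.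
have a0 k : 0 <= a k.
  have [S wS] := word_carrier M k.
  exact: le_trans (spectral_norm_ge0 S) (a_ge _ _ wS).
apply/cvg_lim => //; apply/cvgrPdist_le => e e0.
have [C C0 HC] : exists2 C, 0 < C & wbound (carrier M) (r + e / 2) C.
  by apply: rate1; lra.
have q1 : 1 < (r + e) / (r + e / 2) by rewrite ltr_pdivlMr; lra.
have [k1 Hk1] := eventually_geometric C q1.
have [k2 Hk2] : exists k2, forall k, (k2 <= k)%N -> (0 < k)%N -> r - e <= a k `^ k%:R^-1.
  have [re|re] := leP (r - e) 0.
    by exists 0%N => k _ _; rewrite (le_trans re)// powR_ge0.
  have q2 : 1 < (r - e / 2) / (r - e) by rewrite ltr_pdivlMr; lra.
  have [k2 Hk2] := eventually_geometric (d * d)%:R q2.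
  exists k2 => k k2k k0; rewrite leNgt; apply/negP => /ltW.
  rewrite (powR_inv_le k0 (a0 k) (ltW re)) => ak.
  have re2 : 0 < r - e / 2 by lra.
  have [|C' HC'] := wbound_of_length c0 Mc re2 k0.
    move=> S wS; rewrite (le_trans (mnorm_le_spectral S))//.
    rewrite (@le_trans _ _ ((d * d)%:R * (r - e) ^+ k))//.
      by rewrite ler_wpM2l// (le_trans (a_ge _ _ wS)).
    by rewrite -ler_pdivlMr ?exprn_gt0// -expr_div_n; exact: Hk2.
  by have := rate2 _ _ re2 HC'; lra.
exists (maxn 1 (maxn k1 k2)) => // k /=; rewrite !geq_max => /and3P[k0 k1k k2k].
rewrite ler_distlC; apply/andP; split; first exact: Hk2.
rewrite powR_inv_le ?a0//; last by lra.
apply: ge_sup.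
  have [S wS] := word_carrier M k.
  by exists (spectral_norm S), S => //; rewrite products_word.
move=> _ [S + <-]; rewrite products_word => wS.
rewrite (le_trans (spectral_norm_le _))// (le_trans (HC _ _ wS))//.
have lk : 0 < (r + e / 2) ^+ k by rewrite exprn_gt0//; lra.
by rewrite -ler_pdivlMr// -expr_div_n; exact: Hk1.
Qed.

End SpectralRadius.

(** * Stability of the rate *)

Section Stability.
Variables (R : realType) (s : scalar_kind) (d : nat).
Local Notation K := (base_field R s).
Implicit Types (M N : set 'M[K]_d) (A B S T : 'M[K]_d).

(** This is the [m]-th power of Bernoulli's inequality [u (k+1) <= (1 + u)^k],
    where [u] is proportional to [t] and so small that [(1 + u)^m <= 1 + t/r]. *)
Lemma poly_le_exp (m : nat) (r : R) : 0 < r -> exists2 C : R, 0 < C &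
  forall t k, 0 < t <= 1 -> k.+1%:R ^+ m * r ^+ k <= C * t^-1 ^+ m * (r + t) ^+ k.
Proof.
move=> r0; pose q := Num.max r 1; pose e : R := 2 ^+ m.
have q1 : 1 <= q by rewrite le_max lexx orbT.
have rq : r <= q by rewrite le_max lexx.
have q0 : 0 < q by rewrite (lt_le_trans _ q1).
have e1 : 1 <= e by rewrite exprn_ege1// ler1n.
have e0 : 0 < e by rewrite (lt_le_trans _ e1).
exists ((e * q) ^+ m) => [|t k /andP[t0 t1]]; first by rewrite exprn_gt0// mulr_gt0.
pose u := t / (e * q).
have eq1 : 1 <= e * q by nra.
have u0 : 0 < u by rewrite divr_gt0// mulr_gt0.
have u1 : u <= 1 by rewrite ler_pdivrMr ?mul1r ?mulr_gt0//; lra.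
have um : (1 + u) ^+ m <= 1 + t / r.
  rewrite (le_trans (expr1D_le m _)) ?(ltW u0)//= -/e lerD2l.
  rewrite (@le_trans _ _ (e * u))//; first by rewrite ler_wpM2r ?(ltW u0)//; lra.
  have -> : e * u = t / q by rewrite /u; field; rewrite !gt_eqF.
  by rewrite ler_wpM2l ?(ltW t0)// lef_pV2.
have -> : r + t = r * (1 + t / r) by rewrite mulrDr mulr1 mulrCA divff ?gt_eqF// mulr1.
rewrite [(r * _) ^+ k]exprMn mulrA [X in _ <= X]mulrAC ler_wpM2r ?exprn_ge0 ?(ltW r0)//.
have H : (u * k.+1%:R) ^+ m <= (1 + t / r) ^+ k.
  apply: (@le_trans _ _ (((1 + u) ^+ k) ^+ m)).
    have H : u * k.+1%:R <= (1 + u) ^+ k.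
      have H : -1 <= u by lra.
      by rewrite (le_trans _ (bernoulli_ge k H))// -natr1; nra.
    apply: lerXn2r => //; rewrite nnegrE; first by rewrite mulr_ge0// ltW.
    by rewrite exprn_ge0// addr_ge0// ltW.
  have p1 : 0 <= (1 + u) ^+ m by rewrite exprn_ge0// addr_ge0// ltW.
  have p2 : 0 <= 1 + t / r by rewrite (le_trans p1).
  by rewrite -exprM mulnC exprM; apply: lerXn2r.
rewrite -exprMn.
have -> : k.+1%:R ^+ m = (e * q * t^-1) ^+ m * (u * k.+1%:R) ^+ m :> R.
  rewrite -exprMn; congr (_ ^+ m); rewrite /u.
  by rewrite mulrA -[LHS]mul1r; congr (_ * _); rewrite mulrACA mulrACA;
     field; rewrite ?gt_eqF//.
by rewrite ler_wpM2l// exprn_ge0// divr_ge0 ?mulr_ge0 ?ltW.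
Qed.

Lemma word_scale M (a : K) k T : word [set a *: A | A in M] k T ->
  exists2 S, word M k S & T = a ^+ k *: S.
Proof.
elim: k T => [T ->|k IH _ [_ [A MA <-] [T /IH[S wS ->] <-]]].
  by exists 1%:M; rewrite ?expr0 ?scale1r.
exists (A *m S); first by exists A => //; exists S.
by rewrite -scalemxAl -scalemxAr scalerA exprS.
Qed.

Lemma scale_word M (a : K) k S : word M k S -> 
  word [set a *: A | A in M] k (a ^+ k *: S).
Proof.
elim: k S => [S ->|k IH _ [A MA [S wS <-]]]; first by rewrite expr0 scale1r.
exists (a *: A); first by exists A.
exists (a ^+ k *: S); first exact: IH.
by rewrite -scalemxAl -scalemxAr scalerA exprS.
Qed.

Lemma modulusX (a : K) k : modulus (a ^+ k) = modulus a ^+ k.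
Proof. by elim: k => [|k IH]; rewrite ?expr0 ?modulus1// !exprS modulusM IH. Qed.

(** Bochi's inequality holds with every [l > 0] here. *)
Lemma rate0_nilpotent M c : (0 < d)%N -> 0 < c -> mbounded M c -> is_rate M 0 ->
  forall S, word M d S -> S = 0.
Proof.
move=> d0 c0 Mc [_ rate _] S wS; apply: mnorm_eq0; apply/eqP.
rewrite eq_le mnorm_ge0 andbT.
have [q q0 HB] := @bochi R s d d0.
apply: (@le0_eps _ _ (d%:R * (q * c ^+ d.-1))) => [|e e0].
  by rewrite mulr_ge0// mulr_ge0 ?exprn_ge0 ?ltW.
have [C C0 HC] := rate e e0.
have lipM A : M A -> lip (@mnorm R s d 1) c A.
  by move=> MA x; apply: mnormM_le => //; exact: Mc.
have b0 : 0 <= q * e * c ^+ d.-1.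
  by rewrite mulr_ge0 ?exprn_ge0 ?(ltW c0)// mulr_ge0 ?(ltW q0) ?(ltW e0).
have nm := mnorm_normlike R s d.
rewrite (le_trans (lip_mnorm nm b0 (HB M 1 C _ c e nm ltr01 (ltW c0) lipM e0 C0 HC S wS)))//.
by rewrite le_eqVlt; apply/orP; left; apply/eqP; ring.
Qed.

(** If [r > 0], the set scaled to rate 1 has polynomial growth of degree [d-1],
    which [poly_le_exp] absorbs. If [r = 0], only lengths below [d] matter, and
    [t^(k-(d-1)) >= 1] for them. *)
Lemma rate_wbound M c r : (0 < d)%N -> 0 < c -> mbounded M c -> is_rate M r ->
  exists2 C : R, 0 < C & 
    forall t, 0 < t <= 1 -> wbound M (r + t) (C * t^-1 ^+ d.-1).
Proof.
move=> d0 c0 Mc Mr; have [r0 rate _] := Mr.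
have [rz|rn0] := eqVneq r 0.
  pose c' := Num.max c 1.
  have c1 : 1 <= c' by rewrite le_max lexx orbT.
  have Mc' : mbounded M c' by move=> A /Mc; rewrite le_max => ->.
  exists (d%:R * c' ^+ d) => [|t /andP[t0 t1] k S wS].
    by rewrite mulr_gt0 ?ltr0n// exprn_gt0// (lt_le_trans _ c1).
  have c'0 : 0 <= c' by lra.
  rewrite rz add0r; have [dk|kd] := leqP d k.
    have -> : S = 0.
      move: wS; rewrite -(subnKC dk) => /word_split[S1 [S2 [w1 w2 ->]]].
      rewrite rz in Mr.
      by rewrite (rate0_nilpotent d0 c0 Mc Mr w1) mul0mx.
    by rewrite mnorm0 !mulr_ge0// exprn_ge0// ?invr_ge0 ltW.
  rewrite (le_trans (word_mnorm c'0 Mc' wS))// -!mulrA ler_wpM2l//.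
  rewrite (@le_trans _ _ (c' ^+ d))//; first by rewrite ler_weXn2l// ltnW.
  rewrite -[leLHS]mulr1 ler_wpM2l ?exprn_ge0//.
  have kd1 : (k <= d.-1)%N by rewrite -ltnS prednK.
  rewrite -(subnK kd1) exprD -mulrA -exprMn mulVf ?gt_eqF// expr1n mulr1.
  by rewrite exprn_ege1// invf_ge1.
have {rn0} rp : 0 < r by rewrite lt0r rn0.
pose a := embed s r^-1.
have ma : modulus a = r^-1 by rewrite modulus_embed ger0_norm// invr_ge0.
have [||l l1|C C0 HC] := @polynomial_growth R s d [set a *: A | A in M] (r^-1 * c) d0.
- by rewrite mulr_ge0 ?invr_ge0 ?ltW.
- by move=> _ [A MA <-]; rewrite mnormZ ma ler_wpM2l ?invr_ge0// Mc.
- have [|C C0 HC] := rate (r * l); first by rewrite ltr_pMr.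
  exists C => [|k T /word_scale[S wS ->]]; first exact: ltW.
  rewrite mnormZ modulusX ma exprVn ler_pdivrMl ?exprn_gt0//.
  by rewrite mulrCA -exprMn; exact: HC.
have [C' C'0 HC'] := poly_le_exp d.-1 rp.
exists ((C + 1) * C') => [|t t01 k S wS].
  by rewrite mulr_gt0//; lra.
have H := HC _ _ (scale_word a wS).
rewrite mnormZ modulusX ma exprVn ler_pdivrMl ?exprn_gt0// in H.
apply: (le_trans H).
rewrite mulrCA (mulrC (r ^+ k)) -!mulrA.
apply: ler_pM => //; [by rewrite mulr_ge0 ?exprn_ge0 | by lra |].
by rewrite mulrA; exact: HC'.
Qed.

Lemma rate_le_lip M c r v C q k : 0 < c -> mbounded M c -> is_rate M r ->
  normlike C v -> (0 < k)%N -> 0 < q -> (forall S, word M k S -> lip v q S) ->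
  r ^+ k <= q.
Proof.
move=> c0 Mc [r0 _ rate] nv k0 q0 Hq.
pose l := q `^ k%:R^-1.
have lk : l ^+ k = q.
  rewrite -powR_mulrn ?powR_ge0// -powRrM mulVf ?powRr1 ?(ltW q0)//.
  by rewrite pnatr_eq0 -lt0n.
have l0 : 0 < l by rewrite powR_gt0.
have [|C' HC'] := wbound_of_power (C := d%:R * C) c0 Mc l0 k0.
  move=> j S wS; rewrite lk.
  have := lip_mnorm nv _ (lip_word nv (ltW q0) Hq wS).
  by rewrite exprn_ge0 ?(ltW q0)// => /(_ isT) /le_trans; apply; rewrite mulrCA mulrC.
by rewrite -lk lerXn2r ?nnegrE ?(ltW l0)//; exact: rate HC'.
Qed.

Lemma lipD v a b A B C : normlike C v -> lip v a A -> lip v b B -> lip v (a + b) (A + B).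
Proof.
move=> nv Aa Bb x; rewrite mulmxDl mulrDl (le_trans (normlikeD nv _ _))//.
by rewrite lerD.
Qed.

Lemma lipM v a b A B : 0 <= a -> lip v a A -> lip v b B -> lip v (a * b) (A *m B).
Proof.
move=> a0 Aa Bb x; rewrite -mulmxA (le_trans (Aa _))// -mulrA ler_wpM2l//.
Qed.

Lemma lip_le v a b A C : normlike C v -> a <= b -> lip v a A -> lip v b A.
Proof.
move=> nv ab Aa x; rewrite (le_trans (Aa x))// ler_wpM2r//.
exact: normlike_ge0 nv.
Qed.

(** The factors are replaced one at a time. Each replacement costs [e] relative to
    the bound [b^k] for the product. *)
Lemma word_perturb M N v C b e k S : normlike C v -> 0 < b -> 0 <= e ->
  (forall A, M A -> lip v b A) -> (forall A, N A -> lip v b A) ->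
  (forall A, M A -> exists2 B, N B & lip v (e * b) (A - B)) ->
  word M k S -> exists2 T, word N k T & lip v (k%:R * e * b ^+ k) (S - T).
Proof.
move=> nv b0 e0 Mb Nb MN; elim: k S => [S ->|k IH _ [A MA [S wS <-]]].
  exists 1%:M => // x; rewrite subrr mul0mx !mul0r.
  by rewrite -(scale0r 0) (normlikeZ nv) modulus0 mul0r.
have [B NB AB] := MN A MA; have [T wT ST] := IH S wS.
exists (B *m T); first by exists B => //; exists T.
have -> : A *m S - B *m T = (A - B) *m S + B *m (S - T).
  by rewrite mulmxBl mulmxBr addrA subrK.
have Sb := lip_word nv (ltW b0) Mb wS.
have eb : 0 <= e * b by rewrite mulr_ge0// ltW.
apply: lip_le nv _ (lipD nv (lipM eb AB Sb) (lipM (ltW b0) (Nb B NB) ST)).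
by rewrite le_eqVlt; apply/orP; left; apply/eqP; rewrite -natr1 exprS; ring.
Qed.

(** One half of a Hausdorff estimate, for the entry norm. *)
Definition near_set (a : R) M N := forall A, M A -> exists2 B, N B & mnorm (A - B) <= a.

(** The norm comes from [rate_wbound] and [adapted]. Its distortion is
    [O(t^(1-d))], which turns [t^d] into [O(t)]. *)
Lemma perturbation_norm M c r : (0 < d)%N -> 0 < c -> mbounded M c -> is_rate M r ->
  exists2 C : R, 0 < C & forall t, 0 < t <= 1 -> 
    exists v C', [/\ 0 < C', normlike C' v, forall A, M A -> lip v (r + t) A
      & forall A, mnorm A <= t ^+ d -> lip v (C * t) A].
Proof.
move=> d0 c0 Mc Mr; have [C C0 HC] := rate_wbound d0 c0 Mc Mr.
have [r0 _ _] := Mr.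
exists C => // t t01; have /andP[t0 t1] := t01.
have rt0 : 0 < r + t by rewrite ltr_wpDl.
have nv := adapted_normlike rt0 (HC t t01).
have C'0 : 0 < C * t^-1 ^+ d.-1 by rewrite mulr_gt0// exprn_gt0// invr_gt0.
exists (adapted M (r + t)), (C * t^-1 ^+ d.-1); split=> //.
  by move=> A; exact: adapted_lip (HC t t01) _.
move=> A At x; rewrite (le_trans (normlike_up nv _))//.
have H : mnorm (A *m x) <= t ^+ d * adapted M (r + t) x.
  by apply: mnormM_le => //; exact: (normlike_low nv).
rewrite (le_trans (ler_wpM2l (ltW C'0) H))// mulrA ler_wpM2r ?(normlike_ge0 _ nv)//.
rewrite -mulrA ler_wpM2l ?(ltW C0)// -[d in t ^+ d](prednK d0) exprS mulrCA -exprMn.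
by rewrite mulVf ?gt_eqF// expr1n mulr1.
Qed.

Lemma rate_le_lip1 M c r v C q : 0 < c -> mbounded M c -> is_rate M r ->
  normlike C v -> 0 < q -> (forall A, M A -> lip v q A) -> r <= q.
Proof.
move=> c0 Mc Mr nv q0 Mq; have := @rate_le_lip M c r v C q 1 c0 Mc Mr nv isT q0.
by rewrite expr1 word1; exact.
Qed.

(** Bernoulli's inequality replaces logarithms: if [w = 1 - u] then
    [(1 + n u) w^n <= (1 - u^2)^n <= 1]. *)
Lemma root_lower (q w : R) n : 0 < q -> 0 <= w -> (0 < n)%N ->
  1 / 2 <= q * w ^+ n -> 1 - 2 * q / n%:R <= w.
Proof.
move=> q0 w0 n0 qw; have n0R : 0 < n%:R :> R by rewrite ltr0n.
have [w1|w1] := leP 1 w.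
  by rewrite (le_trans _ w1)// gerBl divr_ge0 ?ltW// mulr_gt0.
pose u := 1 - w; have u0 : 0 < u by rewrite /u; lra.
have H1 : (1 + n%:R * u) * w ^+ n <= 1.
  apply: (@le_trans _ _ ((1 + u) ^+ n * w ^+ n)).
    by rewrite ler_wpM2r ?exprn_ge0// bernoulli_ge//; lra.
  by rewrite -exprMn exprn_ile1// /u; nra.
have wn0 : 0 <= w ^+ n by rewrite exprn_ge0.
rewrite lerBlDr -lerBlDl -/u ler_pdivlMr// mulrC.
have nu : 0 <= n%:R * u by rewrite mulr_ge0// ltW.
move: (n%:R * u) (w ^+ n) nu wn0 H1 qw => X W X0 W0 H1 qw.
have XW : X * W <= 1 by nra.
have : X * (1 / 2) <= X * (q * W) by rewrite ler_wpM2l.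
have : q * (X * W) <= q * 1 by rewrite ler_wpM2l// ltW.
by nra.
Qed.

(** For [n] comparable to [1/t], replacing the factors of a product of length [d n]
    in [M] by nearby ones in [N] costs a small fraction of [(r + C t)^(d n)].
    Bochi's inequality for the set of the products of length [n] in [N] bounds
    the result by a multiple of the [n]-th power of the rate of [N], whereas the
    products in [M] reach the size [r^(d n)]. *)
Lemma rate_lower M c r : (0 < d)%N -> 0 < c -> mbounded M c -> is_rate M r -> 0 < r ->
  exists C t0 : R, 0 < t0 /\ forall t N c' p, 0 < t <= t0 -> 
    mbounded N c' -> is_rate N p ->
    near_set (t ^+ d) M N -> near_set (t ^+ d) N M -> r - C * t <= p.
Proof.
move=> d0 c0 Mc Mr rp.
have [C0 C00 pert] := perturbation_norm d0 c0 Mc Mr.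
have [q q0 HB] := @bochi R s d d0.
pose C1 := 1 + C0; pose C3 := d%:R * (C1 + C0) / r.
have d0R : 0 < d%:R :> R by rewrite ltr0n.
have C30 : 0 < C3 by rewrite divr_gt0// mulr_gt0// /C1; lra.
exists (8 * q * C3 * (r + C1)), (Num.min 1 (2 * C3)^-1).
have i0 : 0 < (2 * C3)^-1 by rewrite invr_gt0 mulr_gt0.
split; first by rewrite lt_min ltr01.
move=> t N c' p /andP[t0]; rewrite le_min => /andP[t1 tC3] Nc' Np MN NM.
have [v [C' [C'0 nv Mv Ev]]] := pert t (introT andP (conj t0 t1)).
pose b := r + C1 * t.
have C1t : 0 < C1 * t by rewrite mulr_gt0// /C1; lra.
have b0 : 0 < b by rewrite addr_gt0.
have rb : r <= b by rewrite lerDl ltW.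
have Mb A : M A -> lip v b A.
  by move=> MA; apply: lip_le nv _ (Mv A MA); rewrite /b /C1; nra.
have Nb B : N B -> lip v b B.
  move=> NB; have [A MA AB] := NM B NB.
  have := lipD nv (Mv A MA) (Ev _ AB).
  by rewrite (addrC A) subrK; apply: lip_le nv _; rewrite /b /C1; lra.
apply/ler_addgt0Pr => eta eta0.
have [p0 Nrate _] := Np.
set l := p + eta; have l0 : 0 < l by rewrite ltr_wpDl.
have [|C C_0 HC] := Nrate l; first by rewrite /l ltrDl.
(* The length n is chosen such that n C3 t <= 1/2, which leaves half of the
   product, and yet 1/n = O(t). *)
pose y := (2 * C3 * t)^-1; pose n := Num.truncn y.
have C3t : 0 < 2 * C3 * t by rewrite mulr_gt0// mulr_gt0.
have y1 : 1 <= y.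
  have C32 : 0 < 2 * C3 by rewrite mulr_gt0.
  rewrite invf_ge1// (le_trans (ler_wpM2l (ltW C32) tC3))// mulfV//.
  by rewrite gt_eqF.
have ny : n%:R <= y by rewrite truncn_le// (le_trans _ y1).
have yn : y < n.+1%:R by rewrite truncnS_gt.
have n0 : (0 < n)%N by rewrite truncn_gt0.
have n1 : 1 <= n%:R :> R by rewrite ler1n.
pose e := C0 * t / b.
have e0 : 0 <= e by rewrite divr_ge0 ?(ltW b0)// mulr_ge0 ?ltW.
have eb : e * b = C0 * t by rewrite /e divfK// gt_eqF.
have dn0 : (0 < d * n)%N by rewrite muln_gt0 d0.
pose Q := (d * n)%:R * e * b ^+ (d * n) + q * l ^+ n * (b ^+ n) ^+ d.-1.
have Q0 : 0 < Q.
  rewrite ltr_wpDl//; first by rewrite mulr_ge0 ?exprn_ge0 ?(ltW b0)// mulr_ge0.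
  by rewrite !mulr_gt0 ?exprn_gt0.
have MQ S : word M (d * n) S -> lip v Q S.
  move=> wS.
  have [|T wT ST] := word_perturb nv b0 e0 Mb Nb _ wS.
    move=> A MA; have [B NB AB] := MN A MA; exists B => //.
    by rewrite eb; exact: Ev.
  rewrite -(subrK T S); apply: (lipD nv ST).
  apply: (HB (word N n) C' C v (b ^+ n) (l ^+ n) nv C'0) => //.
  - by rewrite exprn_ge0 ?ltW.
  - by move=> A; exact: lip_word nv (ltW b0) Nb.
  - by rewrite exprn_gt0.
  - exact: wbound_word.
  - by rewrite word_word.
have := rate_le_lip c0 Mc Mr nv dn0 Q0 MQ.
have bdn : b ^+ (d * n) = (b ^+ n) ^+ d.-1 * b ^+ n.
  by rewrite -exprSr prednK// mulnC exprM.
have bdn0 : 0 < b ^+ (d * n) by rewrite exprn_gt0.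
have -> : Q = ((d * n)%:R * e + q * (l / b) ^+ n) * b ^+ (d * n).
  rewrite /Q mulrDl; congr (_ + _); rewrite bdn expr_div_n.
  by field; rewrite expf_neq0// gt_eqF.
rewrite -ler_pdivrMr// -expr_div_n.
have rb1 : -1 <= r / b - 1 by rewrite lerBrDr addNr divr_ge0// ltW.
have := bernoulli_ge (d * n) rb1; rewrite (addrC 1 (r / b - 1)) subrK.
move=> /le_trans H /H {H}.
have Eb : r / b - 1 = - (C1 * t / b) by rewrite /b; field; rewrite gt_eqF.
rewrite Eb => H.
have brV : b^-1 <= r^-1 by rewrite lef_pV2.
have half : 1 / 2 <= q * (l / b) ^+ n.
  have Hn : n%:R * (C3 * t) <= 1 / 2.
    have : n%:R * (2 * C3 * t) <= y * (2 * C3 * t) by rewrite ler_wpM2r// ltW.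
    by rewrite mulVf ?gt_eqF//; lra.
  have H2 : (d * n)%:R * ((C1 + C0) * t * b^-1) <= n%:R * (C3 * t).
    have -> : n%:R * (C3 * t) = (d * n)%:R * ((C1 + C0) * t * r^-1).
      by rewrite natrM /C3; ring.
    rewrite ler_wpM2l// ler_wpM2l//.
    by rewrite mulr_ge0 ?(ltW t0)// /C1; lra.
  by move: H H2 Hn; rewrite /e; move: (_ * _ ^+ n) => X; lra.
have wl : 0 <= l / b by rewrite divr_ge0 ?ltW.
have := root_lower q0 wl n0 half; rewrite ler_pdivlMr// => H3.
have nV : n%:R^-1 <= 4 * C3 * t.
  have C34 : 0 < 4 * C3 * t by rewrite mulr_gt0// mulr_gt0.
  have n0R : 0 < n%:R :> R by rewrite ltr0n.
  have C34V : 0 < (4 * C3 * t)^-1 by rewrite invr_gt0.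
  rewrite -[leRHS]invrK lef_pV2//.
  have -> : (4 * C3 * t)^-1 = y / 2 by rewrite /y; field; rewrite !gt_eqF.
  by move: yn; rewrite -natr1; lra.
have bC : b <= r + C1 by rewrite /b lerD2l -[leRHS]mulr1 ler_wpM2l// /C1; lra.
have H4 : 2 * q / n%:R * b <= 8 * q * C3 * (r + C1) * t.
  apply: (@le_trans _ _ (2 * q * (4 * C3 * t) * (r + C1))); last by nra.
  have q2 : 0 <= 2 * q by rewrite mulr_ge0// ltW.
  apply: ler_pM => //; last exact: ler_wpM2l.
    by rewrite divr_ge0.
  exact: ltW.
by move: H3; rewrite mulrBl mul1r; lra.
Qed.

Lemma rate_stable M c r : (0 < d)%N -> 0 < c -> mbounded M c -> is_rate M r ->
  exists C t0 : R, [/\ 0 < C, 0 < t0 & forall t N c' p, 0 < t <= t0 -> 0 < c' ->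
    mbounded N c' -> is_rate N p ->
    near_set (t ^+ d) M N -> near_set (t ^+ d) N M -> `|p - r| <= C * t].
Proof.
move=> d0 c0 Mc Mr; have [r0 _ _] := Mr.
have [C0 C00 pert] := perturbation_norm d0 c0 Mc Mr.
have upper t N c' p : 0 < t <= 1 -> 0 < c' -> mbounded N c' -> is_rate N p ->
    near_set (t ^+ d) N M -> p <= r + (1 + C0) * t.
  move=> t01 c'0 Nc' Np NM; have /andP[t0 _] := t01.
  have [v [C' [C'0 nv Mv Ev]]] := pert t t01.
  have b0 : 0 < r + (1 + C0) * t by rewrite ltr_wpDl// mulr_gt0//; lra.
  apply: (rate_le_lip1 c'0 Nc' Np nv b0) => B NB.
  have [A MA AB] := NM B NB; have := lipD nv (Mv A MA) (Ev _ AB).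
  by rewrite (addrC A) subrK; apply: lip_le nv _; lra.
have [rz|rn0] := eqVneq r 0.
  exists (1 + C0), 1; split=> //; first by lra.
  move=> t N c' p t01 c'0 Nc' Np _ NM; have [p0 _ _] := Np.
  by have := upper t N c' p t01 c'0 Nc' Np NM; rewrite rz subr0 ger0_norm// add0r.
have rp : 0 < r by rewrite lt0r rn0.
have [C [t0 [t00 lower]]] := rate_lower d0 c0 Mc Mr rp.
exists (`|C| + 1 + C0), (Num.min t0 1); split.
- by have := normr_ge0 C; lra.
- by rewrite lt_min t00 ltr01.
move=> t N c' p /andP[tp]; rewrite le_min => /andP[tt0 t1] c'0 Nc' Np MN NM.
have H1 : p <= r + (1 + C0) * t by apply: (upper t N c'); rewrite ?tp.
have H2 : r - C * t <= p by apply: (lower t N c'); rewrite ?tp.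
have : C * t <= `|C| * t by rewrite ler_wpM2r ?ler_norm// ltW.
have : 0 <= `|C| * t by rewrite mulr_ge0// ltW.
rewrite ler_norml => H3 H4; apply/andP; split; first by nra.
by nra.
Qed.

End Stability.

(** * Hausdorff distance and pointwise continuity *)

Section HausdorffDistance.
Variables (R : realType) (s : scalar_kind) (d : nat).
Local Notation K := (base_field R s).
Implicit Types (M N : compacts R s d).

Let dist A N := inf [set spectral_norm (A - B) | B in carrier N].

Lemma carrier_nonempty M : exists A, carrier M A.
Proof. by case: M => M [[A MA] ?]; exists A. Qed.

Lemma dist_ge0 A N : 0 <= dist A N.
Proof.
apply: lb_le_inf.
  by have [B NB] := carrier_nonempty N; exists (spectral_norm (A - B)), B.
by move=> _ [B _ <-]; exact: spectral_norm_ge0.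
Qed.

Lemma excess_ub M N : has_ubound [set dist A N | A in carrier M].
Proof.
have [c c0 Mc] := carrier_mbounded M; have [B NB] := carrier_nonempty N.
exists (c + mnorm B) => _ [A MA <-].
apply: (@le_trans _ _ (spectral_norm (A - B))).
  apply: ge_inf; last by exists B.
  by exists 0 => _ [B' _ <-]; exact: spectral_norm_ge0.
rewrite (le_trans (spectral_norm_le _))// (le_trans (mnormD _ _))// mnormN.
by rewrite lerD2r Mc.
Qed.

Lemma dist_le_excess M N A : carrier M A -> dist A N <= excess M N.
Proof. by move=> MA; apply: ub_le_sup; [exact: excess_ub | exists A]. Qed.

Lemma excess_ge0 M N : 0 <= excess M N.
Proof.
have [A MA] := carrier_nonempty M.
exact: le_trans (dist_ge0 A N) (dist_le_excess N MA).
Qed.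

Lemma excess_near M N e : excess M N < e ->
  near_set ((d * d)%:R * e) (carrier M) (carrier N).
Proof.
move=> Me A MA.
have [_ [B NB <-] Be] : exists2 x, [set spectral_norm (A - B) | B in carrier N] x & x < e.
  apply: inf_lt; last exact: le_lt_trans (dist_le_excess N MA) Me.
  by have [B NB] := carrier_nonempty N; exists (spectral_norm (A - B)), B.
exists B => //; rewrite (le_trans (mnorm_le_spectral _))// ler_wpM2l//.
exact: ltW.
Qed.

(** Apply [rate_stable] with [t^d] proportional to the Hausdorff distance [h];
    since [h <= 1] may be assumed, [h `^ d^-1 <= h `^ alpha]. *)
Lemma holder_joint_spectral_radius M (alpha : R) : (0 < d)%N -> 
  0 < alpha <= d%:R^-1 ->
  holder_at (@hausdorff R s d) (@real_dist R) (@joint_spectral_radius R s d) alpha M.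
Proof.
move=> d0 /andP[al0 ald].
have [c c0 Mc] := carrier_mbounded M.
have [C [t0 [C0 t00 HC]]] := rate_stable d0 c0 Mc (joint_spectral_radius_rate M).
pose D : R := (d * d)%:R * 2.
have D0 : 0 < D by rewrite mulr_gt0// ltr0n muln_gt0 d0.
pose h0 := Num.min 1 (t0 ^+ d / D).
have h00 : 0 < h0 by rewrite lt_min ltr01 divr_gt0// exprn_gt0.
pose B := C * D `^ d%:R^-1.
have B0 : 0 <= B by rewrite mulr_ge0 ?(ltW C0)// powR_ge0.
rewrite /holder_at /punctured_limsup.
apply: (@le_lt_trans _ _ B%:E); last by rewrite ltry.
apply: (@le_trans _ _ (ereal_sup
  [set (real_dist (joint_spectral_radius x) (joint_spectral_radius M) /
        hausdorff x M `^ alpha)%:E | x in punctured_ball (@hausdorff R s d) M h0])).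
  by apply: ereal_inf_lbound; exists h0.
apply: ge_ereal_sup => _ [N [_ Nh] <-]; rewrite lee_fin.
set h := hausdorff N M in Nh *.
have hge0 : 0 <= h by rewrite /h /hausdorff le_max excess_ge0.
have [hz|hn0] := eqVneq h 0.
  (* Points at distance 0: the quotient is 0, as 0 `^ alpha = 0 = 0^-1. *)
  by rewrite hz powR0 ?gt_eqF// invr0 mulr0.
have h_gt0 : 0 < h by rewrite lt0r hn0.
have h1 : h <= 1 by move: Nh; rewrite lt_min => /andP[/ltW].
rewrite ler_pdivrMr ?powR_gt0//.
have [c' c'0 Nc'] := carrier_mbounded N.
have Dh : 0 < D * h by rewrite mulr_gt0.
pose t := (D * h) `^ d%:R^-1.
have td : t ^+ d = D * h.
  rewrite -powR_mulrn ?powR_ge0// -powRrM mulVf ?powRr1 ?(ltW Dh)//.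
  by rewrite pnatr_eq0 -lt0n.
have tpos : 0 < t by rewrite powR_gt0.
have tt0 : t <= t0.
  rewrite -(@ler_pXn2r _ d) ?nnegrE ?(ltW t00) ?(ltW tpos)// td mulrC -ler_pdivlMr//.
  by move: Nh; rewrite lt_min => /andP[_ /ltW].
(* The distance is compared strictly with 2 h, so that infima are approximated. *)
have h2 : h < h *+ 2 by rewrite mulr2n ltrDl.
have tdE : t ^+ d = (d * d)%:R * (h *+ 2).
  by rewrite td /D -[h *+ 2]mulr_natl mulrA.
have ne (X Y : compacts R s d) : excess X Y <= h -> near_set (t ^+ d) (carrier X) (carrier Y).
  by move=> XY; rewrite tdE; apply: excess_near; exact: le_lt_trans XY h2.
have tt : 0 < t <= t0 by rewrite tpos.
have := HC t (carrier N) c' _ tt c'0 Nc' (joint_spectral_radius_rate N)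
  (ne M N _) (ne N M _).
rewrite /h /hausdorff !le_max !lexx ?orbT => /(_ isT isT).
rewrite -/(hausdorff N M) -/h /real_dist => /le_trans; apply.
rewrite /B -mulrA ler_wpM2l ?(ltW C0)// /t powRM ?(ltW D0)//.
rewrite ler_wpM2l ?powR_ge0//.
by apply: ger_powR; rewrite ?h_gt0.
Qed.

End HausdorffDistance.

Theorem theorem23 (R : realType) (s : scalar_kind) (d : nat) (hd : (1 <= d)%N) :
  [/\ forall M : compacts R s d,
        joint_spectral_radius M = 0 ->
        holder_at (@hausdorff R s d) (@real_dist R)
          (@joint_spectral_radius R s d) (1 / d%:R) M,
      pointwise_holder (@hausdorff R s d) (@real_dist R)
        (@joint_spectral_radius R s d) (1 / (d ^ 2 + d)%:R)
    & forall M : compacts R s d,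
        finite_set (carrier M) ->
        forall eps : R, 0 < eps ->
        holder_at (@hausdorff R s d) (@real_dist R)
          (@joint_spectral_radius R s d) (1 / (d%:R + eps)) M].
Proof.
have d0 : 0 < d%:R :> R by rewrite ltr0n.
split=> [M _|M|M _ eps eps0]; apply: holder_joint_spectral_radius => //;
  rewrite div1r.
- by rewrite invr_gt0 d0 lexx.
- have dd : 0 < (d ^ 2 + d)%:R :> R by rewrite ltr0n addn_gt0 hd orbT.
  by rewrite invr_gt0 dd lef_pV2// ler_nat leq_addl.
- have de : 0 < d%:R + eps by rewrite addr_gt0.
  by rewrite invr_gt0 de lef_pV2// lerDl ltW.
Qed.
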